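(* Let $p=5$. For every integer $g\geq 4$ one has the following equality of dimensions of irreducible representations of $\mathrm{Sp}(2g,\mathbb{F}_5)$: $$\bigl(\dim V(g,g),\ \dim V(g,g-1),\ \dim V(g,g-2),\ \dim V(g,g-3)\bigr) = \bigl(\mathfrak{e}_g^{(0)}(5),\ \mathfrak{e}_g^{(2)}(5),\ \mathfrak{o}_g^{(2)}(5),\ \mathfrak{o}_g^{(0)}(5)\bigr).$$ Moreover, the same equality holds for $1\leq g<4$ if, for $m=0,1,2,3$, $\dim V(g,g-m)$ on the left hand side is interpreted as $\binom{2g}{k}-\binom{2g}{k-2}$ with $k=g-m$ (binomial coefficients with negative lower index being $0$).
   Context: **The modules $V(g,k)$.** Let $p$ be an odd prime, $K$ a field of characteristic $p$, $g\geq p-1$ and $g-p+2\leq k\leq g$. $V(g,k)$ is Gow's irreducible $\mathrm{Sp}(2g,K)$-module, a natural subquotient of $\Lambda^k V$, where $V\cong K^{2g}$ is the standard representation. When $K$ is algebraically closed, it is the irreducible $\mathrm{Sp}(2g,K)$-module with fundamental highest weight $\omega_k$, i.e. the unique irreducible quotient of the Weyl module given by the kernel of the contraction $\Lambda^kV\to\Lambda^{k-2}V$ induced by the symplectic form. Its dimension depends only on $g$, $k$ and $p$. By a theorem of Gow (known, may be used), for $g\geq p-1$ and $g-p+2\leq k\leq g$, $$\dim V(g,k)=(C^g)_{g+1-k,1},$$ where $C$ is the $(p-1)\times(p-1)$ matrix with $C_{ii}=2$ for $1\le i\le p-1$, $C_{j,j-1}=C_{j-1,j}=1$ for $2\le j\le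 p-1$, and all other entries $0$. **The numbers $\mathfrak{e}_g^{(2c)}(p)$ and $\mathfrak{o}_g^{(2c)}(p)$.** Let $p\geq 5$ be a prime, $g\ge 1$, and $2c$ an even integer with $0\leq 2c\leq p-3$. Let $\mathcal{S}(\Sigma_g(2c))$ be the representation, on a free $\mathbb{Z}[\zeta_p]$-module of finite rank ($\zeta_p$ a primitive $p$-th root of unity), of a central extension of the mapping class group of a genus $g$ surface with at most one boundary component, provided by Integral $\mathrm{SO}(3)$-TQFT (Gilmer–Masbaum), and let $F(\Sigma_g(2c))=\mathcal{S}(\Sigma_g(2c))/(1-\zeta_p)\mathcal{S}(\Sigma_g(2c))$, a representation over $\mathbb{F}_p=\mathbb{Z}[\zeta_p]/(1-\zeta_p)$. It is irreducible if $g\le 1$ or $(g,c)=(2,0)$, and otherwise has a composition series with two irreducible factors, which induce representations of $\mathrm{Sp}(2g,\mathbb{F}_p)$; the dimensions of these factors are denoted $\mathfrak{e}_g^{(2c)}(p)$ and $\mathfrak{o}_g^{(2c)}(p)$ (with $\mathfrak{o}_g^{(2c)}(p)=0$ when $F(\Sigma_g(2c))$ is irreducible). By known results these two numbers are determined (and for the purpose of this statement may be taken as defined) by $$\mathfrak{e}_g^{(2c)}(p)+\mathfrak{o}_g^{(2c)}(p)=D_g^{(2c)}(p),\qquad \mathfrak{e}_g^{(2c)}(p)-\mathfrak{o}_g^{(2c)}(p)=\delta_g^{(2c)}(p),$$ where (Verlinde formula) $$D_g^{(2c)}(p)=\left(\frac p4\right)^{g-1}\sum_{j=1}^{(p-1)/2}\left(\sin\frac{\pi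 j(2c+1)}{p}\right)\left(\sin\frac{\pi j}{p}\right)^{1-2g}$$ and $$\delta_g^{(2c)}(p)=(-1)^c\,\frac4p\sum_{j=1}^{(p-1)/2}\left(\sin\frac{\pi j(2c+1)}{p}\right)\left(\sin\frac{\pi j}{p}\right)\Lambda_j^g,$$ $$\Lambda_j=\left\lceil \frac{p-1}{4}\right\rceil+2\sum_{k=1}^{(p-3)/2}(-1)^k\left\lceil\frac{p-2k-1}{4}\right\rceil\cos\frac{2kj\pi}{p},$$ with $\lceil x\rceil$ the smallest integer $\geq x$. *)

(* Defs.v *)
From HB Require Import structures.
From mathcomp Require Import all_boot all_order all_algebra.
From mathcomp Require Import all_classical all_reals all_analysis.

Set Implicit Arguments.
Unset Strict Implicit.
Unset Printing Implicit Defensive.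

Import Order.TTheory GRing.Theory Num.Theory.

Local Open Scope ring_scope.

(* Vectors of K^n are row vectors and matrices act on the right.  A basis of
   Lambda^k(K^n) is given by the e_{i_1} /\ ... /\ e_{i_k} with
   i_1 < ... < i_k, i.e. it is indexed by the strictly increasing maps
   'I_k -> 'I_n. *)

Definition increasing (k n : nat) (f : {ffun 'I_k -> 'I_n}) : bool :=
  [forall i : 'I_k, forall j : 'I_k, (i < j)%N ==> (f i < f j)%N].

Definition multiindex (k n : nat) := {f : {ffun 'I_k -> 'I_n} | increasing f}.

Definition ext (K : fieldType) (k n : nat) := {ffun multiindex k n -> K^o}.

(* b_1 /\ ... /\ b_k, for the rows b_i of B, in Pluecker coordinates *)
Definition wedge (K : fieldType) (k n : nat) (B : 'M[K]_(k, n)) : ext K k n :=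
  [ffun h : multiindex k n => \det (colsub (val h) B) : K^o].

(* Lambda^k of the endomorphism v |-> v *m A: it sends the basis vector
   e_{f 0} /\ ... /\ e_{f (k-1)} to the wedge of the rows f 0, ..., f (k-1)
   of A. *)
Definition ext_act (K : fieldType) (k n : nat) (A : 'M[K]_n) (x : ext K k n) :
    ext K k n :=
  \sum_(f : multiindex k n) x f *: wedge (rowsub (val f) A).

Definition sympl_form (K : fieldType) (g : nat) : 'M[K]_(g + g) :=
  block_mx 0 1%:M (- 1%:M) 0.

(* matrices preserving the form (v, w) |-> v *m sympl_form *m w^T *)
Definition is_symplectic (K : fieldType) (g : nat) (A : 'M[K]_(g + g)) : Prop :=
  A *m sympl_form K g *m A^T = sympl_form K g.

Definition sp_stable (K : fieldType) (g k : nat)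
    (U : {vspace ext K k (g + g)}) : Prop :=
  forall A : 'M[K]_(g + g), is_symplectic A ->
  forall x, x \in U -> ext_act A x \in U.

(* e_1 /\ ... /\ e_k.  For k <= g it spans the weight space of weight omega_k
   in Lambda^k(K^(2g)) (for the diagonal torus). *)
Definition high_vector (K : fieldType) (g k : nat) : ext K k (g + g) :=
  wedge (\matrix_(i < k, j < g + g) (i == j :> nat)%:R).

(* Gow's module V(g, k), as a subquotient gow_top / gow_bot of Lambda^k(K^(2g)): it is an
   irreducible Sp(2g, K)-module, and it has highest weight omega_k because the
   image in it of e_1 /\ ... /\ e_k is nonzero (this also makes it nonzero).
   It is the irreducible quotient of the submodule (the Weyl module) generated
   by this vector; in characteristic p the latter may be smaller than the
   kernel of the contraction Lambda^k -> Lambda^(k-2). *)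
Record gow_module (K : fieldType) (g k : nat) := GowModule {
  gow_top : {vspace ext K k (g + g)};
  gow_bot : {vspace ext K k (g + g)};
  gow_top_stable : sp_stable gow_top;
  gow_bot_stable : sp_stable gow_bot;
  gow_sub : (gow_bot <= gow_top)%VS;
  gow_high_top : high_vector K g k \in gow_top;
  gow_high_bot : high_vector K g k \notin gow_bot;
  gow_irreducible : forall U : {vspace ext K k (g + g)}, sp_stable U ->
    (gow_bot <= U)%VS -> (U <= gow_top)%VS -> U = gow_bot \/ U = gow_top }.

Definition gow_dim (K : fieldType) (g k : nat) (V : gow_module K g k) : nat :=
  (\dim (gow_top V) - \dim (gow_bot V))%N.

Lemma high_vector_neq0 (K : fieldType) (g k : nat) :
  (k <= g)%N -> high_vector K g k != 0.
Proof.
move=> kg; have kgg : (k <= g + g)%N by apply: leq_trans kg (leq_addr _ _).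
have incr : increasing [ffun i : 'I_k => widen_ord kgg i].
  by apply/forallP => i; apply/forallP => j; apply/implyP; rewrite !ffunE.
pose h : multiindex k (g + g) := Sub [ffun i : 'I_k => widen_ord kgg i] incr.
apply/eqP => /ffunP /(_ h); rewrite !ffunE /=.
suff -> : colsub [ffun i : 'I_k => widen_ord kgg i]
    (\matrix_(i < k, j < g + g) (i == j :> nat)%:R) = 1%:M :> 'M[K]_k.
  by rewrite det1; apply/eqP; rewrite oner_eq0.
by apply/matrixP => i j; rewrite !mxE ffunE.
Qed.

Lemma gow_module_exists (K : fieldType) (g k : nat) :
  (k <= g)%N -> inhabited (gow_module K g k).
Proof.
move=> kg; pose v := high_vector K g k.
have act0 (A : 'M[K]_(g + g)) : ext_act A (0 : ext K k (g + g)) = 0.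
  by rewrite /ext_act big1 // => f _; rewrite ffunE scale0r.
pose P d := `[< exists M : {vspace ext K k (g + g)},
  [/\ sp_stable M, v \in M & \dim M = d] >].
have exP : exists d, P d.
  exists (\dim {:ext K k (g + g)}); apply/asboolP; exists fullv.
  by split; rewrite ?memvf // => A _ x _; rewrite memvf.
case: (ex_minnP exP) => d /asboolP[M [Mst vM dM]] Mmin.
pose Q d := `[< exists N : {vspace ext K k (g + g)},
  [/\ sp_stable N, (N <= M)%VS, v \notin N & \dim N = d] >].
have exQ : exists d, Q d.
  exists 0%N; apply/asboolP; exists 0%VS; split; rewrite ?sub0v ?dimv0 //.
    by move=> A _ x; rewrite !memv0 => /eqP ->; rewrite act0.
  by rewrite memv0 high_vector_neq0.
have ubQ d' : Q d' -> (d' <= d)%N.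
  by move=> /asboolP[N [_ NM _ <-]]; rewrite -dM dimvS.
case: (ex_maxnP exQ ubQ) => e /asboolP[N [Nst NM vN dN]] Nmax.
constructor; apply: (@GowModule K g k M N) => // U Ust NU UM.
have [vU|vU] := boolP (v \in U); [right|left]; apply/eqP.
  rewrite eqEdim UM dM; apply: Mmin; apply/asboolP; by exists U.
rewrite eq_sym eqEdim NU dN; apply: Nmax; apply/asboolP; by exists U.
Qed.

Definition verlinde (R : realType) (p g c : nat) : R :=
  (p%:R / 4) ^ (g%:Z - 1) *
  \sum_(1 <= j < ((p - 1) %/ 2).+1)
    sin (pi * j%:R * (2 * c + 1)%N%:R / p%:R) *
    sin (pi * j%:R / p%:R) ^ (1 - 2 * g%:Z).

Definition Lambda (R : realType) (p j : nat) : R :=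
  (Num.ceil ((p%:R - 1) / 4 : R))%:~R +
  2 * \sum_(1 <= k < ((p - 3) %/ 2).+1)
    (-1) ^+ k * (Num.ceil ((p%:R - 2 * k%:R - 1) / 4 : R))%:~R *
    cos (2 * k%:R * j%:R * pi / p%:R).

Definition delta (R : realType) (p g c : nat) : R :=
  (-1) ^+ c * (4 / p%:R) *
  \sum_(1 <= j < ((p - 1) %/ 2).+1)
    sin (pi * j%:R * (2 * c + 1)%N%:R / p%:R) * sin (pi * j%:R / p%:R) *
    Lambda R p j ^+ g.

(* The solution of e + o = verlinde, e - o = delta; the superscript (2c) is
   represented by the argument c. *)
Definition e_dim (R : realType) (p g c : nat) : R :=
  (verlinde R p g c + delta R p g c) / 2.

Definition o_dim (R : realType) (p g c : nat) : R :=
  (verlinde R p g c - delta R p g c) / 2.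

Lemma e_dimDo_dim (R : realType) (p g c : nat) :
  e_dim R p g c + o_dim R p g c = verlinde R p g c.
Proof. by rewrite /e_dim /o_dim -mulrDl addrACA subrr addr0 mulrDl -splitr. Qed.

Lemma e_dimBo_dim (R : realType) (p g c : nat) :
  e_dim R p g c - o_dim R p g c = delta R p g c.
Proof. by rewrite /e_dim /o_dim -mulrBl opprD opprK addrACA subrr add0r mulrDl -splitr. Qed.

(* binomial coefficients with a negative lower index are 0 *)

Definition binz (n : nat) (k : int) : nat :=
  if k is Posz i then 'C(n, i) else 0%N.

Definition weyl_dim (g : nat) (k : int) : int :=
  (binz (2 * g) k)%:Z - (binz (2 * g) (k - 2))%:Z.

(* Main.v *)
Require Import Defs.
From HB Require Import structures.
From mathcomp Require Import all_boot all_order all_algebra.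
From mathcomp Require Import perm ring lra zify.
From mathcomp Require Import all_classical all_reals all_analysis.

Set Implicit Arguments.
Unset Strict Implicit.
Unset Printing Implicit Defensive.

Import Order.TTheory GRing.Theory Num.Theory.
Local Open Scope ring_scope.

(* Lambda^k is paired with itself by <x_1 /\ ... /\ x_k, y_1 /\ ... /\ y_k> =
   det (x_i J y_j^T).  The span W of the wedges of isotropic k-frames is the
   Sp-module generated by e_1 /\ ... /\ e_k (every independent isotropic frame
   extends to a symplectic basis), and a torus argument shows that its largest
   submodule missing this vector is the radical of the form on W; hence the
   dimension of Gow's module is the rank of the form on W.

   This rank is computed by induction on g.  Adding a hyperbolic plane <e, f>
   makes W the orthogonal sum of the images of W_(k-1) /\ e + W_(k-1) /\ f, of
   W_k, and of the vectors omega /\ x / (m + 1) - x /\ e /\ f with x in W_(k-2),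
   where m = g - k; on the latter the form is (m + 2) / (m + 1) times the form of
   W_(k-2), so that in characteristic 5 they contribute nothing for m = 3.  This
   is the recursion of the powers of the matrix C.  On the other side, for p = 5
   the Verlinde numbers and their signed versions are combinations of powers of
   the eigenvalues of C, written in terms of c = cos (pi / 5), 4 c^2 = 2 c + 1. *)

(** * Alternating maps *)

(** The vector omega /\ x / (m + 1) - x /\ e /\ f lies in W because it is the average of p_i /\ q_i
    /\ x - e /\ f /\ x over the m + 1 hyperbolic pairs (p_i, q_i) complementing x, and each such
    difference is a combination of three isotropic wedges. The averaging needs m + 1 invertible,
    which in characteristic 5 is the range m <= 3. The factor (m + 2) / (m + 1) comes from
    adjunction: wedging with the full bivector omega + e /\ f is adjoint to contraction, and
    contraction kills isotropic wedges. So against W the term omega /\ x may be replaced by - e /\ f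
    /\ x. The torus argument has to work over the prime field too. It uses one scalar [a] with [a],
    1 and its inverse distinct, and 2 is such a scalar in characteristic 5. The eigenvalues of C are
    2 + 2 cos (j pi / 5) for j = 1, ..., 4, that is 2 + 2c, 1 + 2c, 3 - 2c, 2 - 2c. The Verlinde sum
    involves the first and third, the signed sum the other two. *)

Section AlternatingMaps.

Variable K : fieldType.

(** The rows are the arguments. Linearity is phrased through hypotheses on rows, so that it applies
    to matrices built by [col_mx], products or row selections alike. *)
Definition alternating (k n : nat) (U : lmodType K) (phi : 'M[K]_(k, n) -> U) : Prop :=
  (forall i a b (A B C : 'M[K]_(k, n)),
     row i A = a *: row i B + b *: row i C ->
     (forall j, j != i -> row j B = row j A) ->
     (forall j, j != i -> row j C = row j A) ->
     phi A = a *: phi B + b *: phi C)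
  /\ (forall i j (A : 'M[K]_(k, n)), i != j -> row i A = row j A -> phi A = 0).

Section Theory.
Variables (k n : nat) (U : lmodType K).
Implicit Types (phi psi : 'M[K]_(k, n) -> U) (A B : 'M[K]_(k, n)).

Definition set_row i (v : 'rV[K]_n) A : 'M[K]_(k, n) :=
  \matrix_j (if j == i then v else row j A).

Lemma row_set_row i v A : row i (set_row i v A) = v.
Proof. by rewrite rowK eqxx. Qed.

Lemma row_set_row_neq i j v A : j != i -> row j (set_row i v A) = row j A.
Proof. by rewrite rowK => /negbTE ->. Qed.

Lemma set_row_id i A : set_row i (row i A) A = A.
Proof. by apply/row_matrixP => j; rewrite rowK; case: eqP => // ->. Qed.

Lemma alt_set_row phi i A a b (u v : 'rV_n) : alternating phi ->
  phi (set_row i (a *: u + b *: v) A) =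
    a *: phi (set_row i u A) + b *: phi (set_row i v A).
Proof.
case=> lin _; apply: (lin i); first by rewrite !row_set_row.
  by move=> j ji; rewrite !row_set_row_neq.
by move=> j ji; rewrite !row_set_row_neq.
Qed.

Lemma alt_set_rowD phi i A (u v : 'rV_n) : alternating phi ->
  phi (set_row i (u + v) A) = phi (set_row i u A) + phi (set_row i v A).
Proof.
by move=> aphi; rewrite -[u]scale1r -[v]scale1r alt_set_row // !scale1r.
Qed.

Lemma alt_set_row0 phi i A : alternating phi -> phi (set_row i 0 A) = 0.
Proof.
move=> aphi; have := alt_set_row i A 0 0 0 0 aphi.
by rewrite !scale0r !addr0.
Qed.

Lemma alt_set_rowZ phi i A a (u : 'rV_n) : alternating phi ->
  phi (set_row i (a *: u) A) = a *: phi (set_row i u A).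
Proof.
move=> aphi; have := alt_set_row i A a 0 u 0 aphi.
by rewrite !scale0r !addr0.
Qed.

Lemma alt_set_row_sum phi i A (I : finType) (a : I -> K) (u : I -> 'rV_n) :
    alternating phi ->
  phi (set_row i (\sum_r a r *: u r) A) = \sum_r a r *: phi (set_row i (u r) A).
Proof.
move=> aphi.
apply: (big_ind2 (fun x y => phi (set_row i x A) = y)).
- exact: alt_set_row0.
- by move=> x1 x2 y1 y2 <- <-; rewrite alt_set_rowD.
- by move=> r _; rewrite alt_set_rowZ.
Qed.

(** Polarization: expand the value at the matrix that carries the sum of the two rows in both
    places. *)
Lemma alt_xrow phi i j A : alternating phi -> i != j ->
  phi (xrow i j A) = - phi A.
Proof.
move=> aphi ij; have alt0 := aphi.2.
pose M u v := set_row i u (set_row j v A).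
have Mi u v : row i (M u v) = u by rewrite row_set_row.
have Mj u v : row j (M u v) = v.
  by rewrite row_set_row_neq ?row_set_row // eq_sym.
have M0 u : phi (M u u) = 0 by apply: (alt0 i j) => //; rewrite Mi Mj.
have MA : M (row i A) (row j A) = A.
  by apply/row_matrixP => r; rewrite !rowK; do 2!case: eqP => [->|] //.
have MxA : M (row j A) (row i A) = xrow i j A.
  apply/row_matrixP => r; rewrite !rowK; apply/rowP => c; rewrite !mxE.
  by case: tpermP => [->|->|]; rewrite ?eqxx ?mxE //=;
    [rewrite eq_sym (negbTE ij) mxE|do 2!move/eqP/negbTE ->; rewrite mxE].
have MDl u v w : phi (M (u + v) w) = phi (M u w) + phi (M v w).
  exact: alt_set_rowD.
have MDr u v w : phi (M u (v + w)) = phi (M u v) + phi (M u w).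
  have com x y : M x y = set_row j y (set_row i x A).
    apply/row_matrixP => r; rewrite !rowK; case: (r =P i) => [->|//].
    by rewrite (negbTE ij).
  by rewrite !com alt_set_rowD.
have := M0 (row i A + row j A).
rewrite MDr !MDl !M0 add0r addr0.
by rewrite MA MxA => /eqP; rewrite addr_eq0 => /eqP.
Qed.

(** Each transposition in a factorization of [s] changes the value by a sign at most; speaking of
    vanishing alone avoids tracking the signature. *)
Lemma alt_row_perm_eq0 phi (s : 'S_k) A : alternating phi ->
  phi (row_perm s A) = 0 -> phi A = 0.
Proof.
move=> aphi; have [ts -> _] := prod_tpermP s.
elim: ts A => [|[i j] ts IH] A; first by rewrite big_nil row_perm1.
rewrite big_cons row_permM /= => H; apply: IH; move: H.
have [->|ij] := eqVneq i j; first by rewrite tperm1 row_perm1.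
by rewrite -/(xrow i j _) alt_xrow // => /eqP; rewrite oppr_eq0 => /eqP.
Qed.

Lemma sort_injection (h : 'I_k -> 'I_n) : injective h ->
  exists s : 'S_k, increasing [ffun i => h (s i)].
Proof.
move=> h_inj.
pose leo := relpre (val : 'I_n -> nat) leq.
pose t := sort leo (mktuple h).
have tP : perm_eq t (mktuple h) by rewrite perm_sort.
have leo_tr : transitive leo by move=> y x z; apply: leq_trans.
have t_sorted : sorted leo t by apply: sort_sorted => x y; exact: leq_total.
have /tuple_permP[s ts] := tP.
exists s; apply/forallP => i; apply/forallP => j; apply/implyP => ij.
rewrite !ffunE ltn_neqAle (inj_eq val_inj) (inj_eq h_inj) (inj_eq perm_inj).
have -> : i != j by apply: contraTneq ij => ->; rewrite ltnn.
have nth_t (r : 'I_k) : h (s r) = nth (h i) t r.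
  by rewrite ts -tnth_nth !tnth_mktuple.
rewrite !nth_t.
have sz : size t = k by rewrite (perm_size tP) size_tuple.
apply: (sorted_ltn_nth leo_tr (h i) t_sorted) => //; by rewrite inE sz.
Qed.

(** Uniqueness half of the universal property of Lambda^k: multilinearity reduces to rows that are
    basis vectors, and such a family either repeats a vector or can be sorted into an increasing
    one. *)
Lemma alt_eq0 phi : alternating phi ->
    (forall f : multiindex k n, phi (rowsub (val f) 1%:M) = 0) ->
  forall A, phi A = 0.
Proof.
move=> aphi phi0.
have phi_basis (h : 'I_k -> 'I_n) : phi (rowsub h 1%:M) = 0.
  have [/injectiveP h_inj|] := boolP (injectiveb h); last first.
    case/injectivePn => i [j ij hij]; apply: (aphi.2 i j) => //.
    by rewrite !row_rowsub hij.
  have [s s_incr] := sort_injection h_inj.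
  apply: (alt_row_perm_eq0 aphi (s := s)).
  have := phi0 (Sub _ s_incr); rewrite SubK => <-; congr phi.
  by apply/matrixP => i j; rewrite !mxE ffunE.
(* [t] bounds the leading rows that are still arbitrary; the rows from [t] on are basis vectors. The
   inductive step expands row [t] in the standard basis. *)
have step t : forall A, (forall i : 'I_k, (t <= i)%N -> exists r, row i A = delta_mx 0 r) ->
    phi A = 0.
  elim: t => [|t IH] A tA.
    pose h i := projT1 (cid (tA i (leq0n i))).
    rewrite -(phi_basis h); congr phi; apply/row_matrixP => i.
    by rewrite (projT2 (cid (tA i (leq0n i)))) row_rowsub row1.
  case: (ltnP t k) => [tk|kt]; last first.
    by apply: IH => i /(leq_trans kt); rewrite leqNgt ltn_ord.
  pose i0 := Ordinal tk.
  rewrite -(set_row_id i0 A) [row i0 A]row_sum_delta alt_set_row_sum //.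
  rewrite big1 // => r _; rewrite IH ?scaler0 // => i ti.
  have [->|ii0] := eqVneq i i0; first by exists r; rewrite row_set_row.
  rewrite row_set_row_neq //; apply: tA.
  by rewrite ltn_neqAle ti andbT; apply: contraNneq ii0 => e; apply/eqP/val_inj.
by move=> A; apply: (step k) => i; rewrite leqNgt ltn_ord.
Qed.

Lemma altD phi psi : alternating phi -> alternating psi ->
  alternating (fun A => phi A + psi A).
Proof.
move=> [p1 p2] [q1 q2]; split=> [i a b A B C eA eB eC|i j A ij eA].
  rewrite (p1 _ _ _ _ _ _ eA eB eC) (q1 _ _ _ _ _ _ eA eB eC).
  by rewrite !scalerDr addrACA.
by rewrite (p2 _ _ _ ij eA) (q2 _ _ _ ij eA) addr0.
Qed.

Lemma altZ c phi : alternating phi -> alternating (fun A => c *: phi A).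
Proof.
move=> [p1 p2]; split=> [i a b A B C eA eB eC|i j A ij eA].
  rewrite (p1 _ _ _ _ _ _ eA eB eC) scalerDr !scalerA.
  by rewrite [c * a]mulrC [c * b]mulrC.
by rewrite (p2 _ _ _ ij eA) scaler0.
Qed.

Lemma altN phi : alternating phi -> alternating (fun A => - phi A).
Proof.
move=> /(altZ (-1)) [p1 p2]; split=> [i a b A B C|i j A] *.
  by rewrite -!scaleN1r; apply: (p1 i).
by rewrite -scaleN1r; apply: (p2 i j).
Qed.

Lemma alt_sum (I : finType) (F : I -> 'M[K]_(k, n) -> U) :
  (forall i, alternating (F i)) -> alternating (fun A => \sum_i F i A).
Proof.
move=> aF; split=> [i a b A B C eA eB eC|i j A ij eA].
  rewrite !scaler_sumr -big_split; apply: eq_bigr => r _.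
  exact: ((aF r).1 i).
by rewrite big1 // => r _; apply: ((aF r).2 i j).
Qed.

End Theory.

Lemma det_alternating n :
  alternating (fun A : 'M[K]_n => \det A : K^o).
Proof.
split=> [i a b A B C eA eB eC|i j A ij eA].
  have ne j : lift i j != i by rewrite eq_sym neq_lift.
  apply: (determinant_multilinear eA); apply/matrixP => j c; rewrite !mxE.
    by move/rowP: (eB _ (ne j)) => /(_ c); rewrite !mxE.
  by move/rowP: (eC _ (ne j)) => /(_ c); rewrite !mxE.
apply: (determinant_alternate ij) => c.
by move/rowP: eA => /(_ c); rewrite !mxE.
Qed.

Lemma alt_col_mx (t k n n' : nat) (U : lmodType K) (phi : 'M[K]_(t + k, n') -> U)
    (X : 'M[K]_(t, n')) (P : 'M[K]_(n, n')) :
  alternating phi -> alternating (fun A : 'M[K]_(k, n) => phi (col_mx X (A *m P))).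
Proof.
move=> aphi.
split=> [i a b A B C eA eB eC|i j A ij eA]; last first.
  apply: (aphi.2 (rshift t i) (rshift t j)); first by rewrite (inj_eq (@rshift_inj _ _)).
  by rewrite !rowKd !row_mul eA.
apply: (aphi.1 (rshift t i)) => [|j|j].
- by rewrite !rowKd !row_mul eA mulmxDl -!scalemxAl.
- case: (split_ordP j) => r -> ri; rewrite ?rowKu // !rowKd !row_mul eB //.
  by apply: contraNneq ri => ->.
- case: (split_ordP j) => r -> ri; rewrite ?rowKu // !rowKd !row_mul eC //.
  by apply: contraNneq ri => ->.
Qed.

Lemma alt_mulmxr (k n n' : nat) (U : lmodType K) (phi : 'M[K]_(k, n') -> U)
    (P : 'M[K]_(n, n')) :
  alternating phi -> alternating (fun A : 'M[K]_(k, n) => phi (A *m P)).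
Proof.
move=> aphi; split=> [i a b A B C eA eB eC|i j A ij eA]; last first.
  by apply: (aphi.2 i j); rewrite // !row_mul eA.
apply: (aphi.1 i) => [|j ji|j ji]; rewrite !row_mul ?(eB j) ?(eC j) //.
by rewrite eA mulmxDl -!scalemxAl.
Qed.

Section Wedge.
Variables k n : nat.
Implicit Types (U : lmodType K) (A B : 'M[K]_(k, n)).

Lemma wedge_alternating : alternating (@wedge K k n).
Proof.
split=> [i a b A B C eA eB eC|i j A ij eA]; apply/ffunP => f; rewrite !ffunE.
  apply: ((@det_alternating k).1 i) => [|j ji|j ji].
  - by apply/rowP => c; move/rowP: eA => /(_ (val f c)); rewrite !mxE.
  - by apply/rowP => c; move/rowP: (eB _ ji) => /(_ (val f c)); rewrite !mxE.
  - by apply/rowP => c; move/rowP: (eC _ ji) => /(_ (val f c)); rewrite !mxE.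
apply: ((det_alternating k).2 i j) => //.
by apply/rowP => c; move/rowP: eA => /(_ (val f c)); rewrite !mxE.
Qed.

Definition basis_ext (f : multiindex k n) : ext K k n := wedge (rowsub (val f) 1%:M).

Lemma multiindex_ltn (f : multiindex k n) (i j : 'I_k) :
  (i < j)%N -> (val f i < val f j)%N.
Proof. by move=> ij; have /forallP/(_ i)/forallP/(_ j)/implyP := valP f; apply. Qed.

Lemma multiindex_inj (f : multiindex k n) : injective (val f).
Proof.
move=> i j e; apply/val_inj; case: (ltngtP i j) => // /(multiindex_ltn f);
by rewrite e ltnn.
Qed.

(** A strictly increasing map is recovered from its image by sorting; the two codomains are sorted
    lists of the same size without repetition, one contained in the other. *)
Lemma multiindex_eq (f h : multiindex k n) :
  (forall i, val f i \in codom (val h)) -> f = h.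
Proof.
move=> fh; apply/val_inj/ffunP => i.
pose lto := relpre (val : 'I_n -> nat) ltn.
have lto_tr : transitive lto by move=> y x z; apply: ltn_trans.
have lto_irr : irreflexive lto by move=> x; apply: ltnn.
have srt (u : multiindex k n) : sorted lto (codom (val u)).
  rewrite codomE; apply: (@homo_sorted _ _ (val u) (relpre val ltn)).
    by move=> x y; exact: multiindex_ltn.
  by rewrite -sorted_map val_enum_ord iota_ltn_sorted.
have unq (u : multiindex k n) : uniq (codom (val u)).
  by rewrite map_inj_uniq ?enum_uniq //; exact: multiindex_inj.
have sub : {subset codom (val f) <= codom (val h)}.
  by move=> x /codomP[j ->].
have e : codom (val f) = codom (val h).
  apply: (irr_sorted_eq lto_tr lto_irr) => //.
  by apply: (uniq_min_size (unq f) sub _).2; rewrite !size_codom.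
have := congr1 (fun s => nth (val f i) s i) e.
rewrite !codomE /= !(nth_map i) -?enumT ?size_enum_ord //.
by rewrite !nth_ord_enum.
Qed.

Lemma basis_extE f h : basis_ext f h = (f == h)%:R.
Proof.
rewrite ffunE; case: eqP => [<-|fh].
  suff -> : colsub (val f) (rowsub (val f) 1%:M) = 1%:M :> 'M[K]_k by rewrite det1.
  by apply/matrixP => i j; rewrite !mxE (inj_eq (@multiindex_inj f)).
have [/forallP all_in|] := boolP [forall i, val f i \in codom (val h)].
  by case: fh; apply: multiindex_eq.
case/forallPn => i fi; rewrite (expand_det_row _ i) big1 // => j _.
rewrite !mxE; case: eqP fi => [-> |_ _]; last by rewrite mul0r.
by rewrite codom_f.
Qed.

Lemma ext_basis (x : ext K k n) : x = \sum_f x f *: basis_ext f.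
Proof.
apply/ffunP => h; rewrite sum_ffunE (bigD1 h) //= big1 ?addr0.
  by rewrite ffunE basis_extE eqxx; apply/esym/mulr1.
by move=> f fh; rewrite ffunE basis_extE (negbTE fh) scaler0.
Qed.

(** Existence half of the universal property: the map induced on Lambda^k. It is linear for every
    [phi]; alternation enters in its value on wedges. *)
Definition ext_lift U (phi : 'M[K]_(k, n) -> U) (x : ext K k n) : U :=
  \sum_f x f *: phi (rowsub (val f) 1%:M).

Lemma ext_lift_linear U (phi : 'M[K]_(k, n) -> U) : linear (ext_lift phi).
Proof.
move=> a x y; rewrite /ext_lift scaler_sumr -big_split; apply: eq_bigr => f _.
by rewrite !ffunE scalerDl scalerA.
Qed.

Lemma ext_lift_wedge U (phi : 'M[K]_(k, n) -> U) A :
  alternating phi -> ext_lift phi (wedge A) = phi A.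
Proof.
move=> aphi; apply/eqP; rewrite -subr_eq0; apply/eqP.
have awedge := wedge_alternating.
apply: (@alt_eq0 k n U (fun A => ext_lift phi (wedge A) - phi A)).
  apply: altD; last exact: altN.
  split=> [i a b A1 B C eA eB eC|i j A1 ij eA].
    rewrite (awedge.1 _ _ _ _ _ _ eA eB eC).
    rewrite -[b *: _]addr0 !ext_lift_linear; congr (_ + _).
    by rewrite /ext_lift [X in _ + X]big1 ?addr0 // => f _; rewrite ffunE scale0r.
  rewrite (awedge.2 _ _ _ ij eA).
  by rewrite /ext_lift big1 // => f _; rewrite ffunE scale0r.
move=> f; rewrite -/(basis_ext f) /ext_lift (bigD1 f) //= big1.
  by rewrite basis_extE eqxx scale1r addr0 subrr.
by move=> h hf; rewrite basis_extE eq_sym (negbTE hf) scale0r.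
Qed.

HB.instance Definition _ U (phi : 'M[K]_(k, n) -> U) :=
  GRing.isLinear.Build K (ext K k n) U _ (ext_lift phi) (ext_lift_linear phi).

End Wedge.

End AlternatingMaps.

(** * Gram matrices *)

Section GramRank.

Variables (K : fieldType) (E : vectType K) (form : E -> E -> K).
Hypothesis form_linl : forall a x y z, form (a *: x + y) z = a * form x z + form y z.
Hypothesis form_linr : forall a x y z, form z (a *: x + y) = a * form z x + form z y.

Lemma form_suml (I : finType) (c : I -> K) (x : I -> E) z :
  form (\sum_i c i *: x i) z = \sum_i c i * form (x i) z.
Proof.
have form0 : form 0 z = 0.
  by have := form_linl (-1) 0 0 z; rewrite scaler0 addr0 mulN1r addNr.
apply: (big_ind2 (fun u v => form u z = v)) => // [u1 v1 u2 v2 <- <-|i _].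
  by rewrite -[u1]scale1r form_linl mul1r scale1r.
by rewrite -[_ *: _]addr0 form_linl form0 addr0.
Qed.

Lemma form_sumr (I : finType) (c : I -> K) (x : I -> E) z :
  form z (\sum_i c i *: x i) = \sum_i c i * form z (x i).
Proof.
have form0 : form z 0 = 0.
  by have := form_linr (-1) 0 0 z; rewrite scaler0 addr0 mulN1r addNr.
apply: (big_ind2 (fun u v => form z u = v)) => // [u1 v1 u2 v2 <- <-|i _].
  by rewrite -[u1]scale1r form_linr mul1r scale1r.
by rewrite -[_ *: _]addr0 form_linr form0 addr0.
Qed.

Definition gram a b (x : 'I_a -> E) (y : 'I_b -> E) : 'M[K]_(a, b) :=
  \matrix_(i, j) form (x i) (y j).

Definition fam_span a (x : 'I_a -> E) : {vspace E} := (\sum_i <[x i]>)%VS.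

Lemma mem_fam a (x : 'I_a -> E) i : x i \in fam_span x.
Proof. by apply: (subvP (sumv_sup i _ (subvv _))) => //; exact: memv_line. Qed.

Lemma fam_span_sub a (x : 'I_a -> E) (U : {vspace E}) :
  (forall i, x i \in U) -> (fam_span x <= U)%VS.
Proof. by move=> xU; apply/subv_sumP => i _; rewrite -memvE. Qed.

Lemma fam_spanP a (x : 'I_a -> E) v :
  reflect (exists c : 'I_a -> K, v = \sum_i c i *: x i) (v \in fam_span x).
Proof.
apply: (iffP memv_sumP) => [[u ux ->]|[c ->]].
  have cP i : exists c, u i = c *: x i by apply/vlineP/ux.
  exists (fun i => projT1 (cid (cP i))); apply: eq_bigr => i _.
  exact: (projT2 (cid (cP i))).
by exists (fun i => c i *: x i) => // i _; apply/memvZ/memv_line.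
Qed.

(** Writing x = C y turns one Gram matrix into C G C^T. Consequently the rank depends on the span
    alone and can be read off any spanning family, dependent or not. *)
Lemma rank_gram_le a b (x : 'I_a -> E) (y : 'I_b -> E) :
  (forall i, x i \in fam_span y) -> (\rank (gram x x) <= \rank (gram y y))%N.
Proof.
move=> xy.
have cP i : exists c : 'I_b -> K, x i = \sum_j c j *: y j by apply/fam_spanP/xy.
pose C : 'M[K]_(a, b) := \matrix_(i, j) projT1 (cid (cP i)) j.
have xE i : x i = \sum_j C i j *: y j.
  rewrite {1}(projT2 (cid (cP i))); apply: eq_bigr => j _; by rewrite mxE.
have -> : gram x x = C *m gram y y *m C^T.
  apply/matrixP => i j; rewrite !mxE {1}xE form_suml.
  under eq_bigr => r _ do rewrite xE form_sumr mulr_sumr.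
  rewrite exchange_big; apply: eq_bigr => s _; rewrite !mxE mulr_suml.
  by apply: eq_bigr => r _; rewrite !mxE; ring.
by apply: leq_trans (mxrankM_maxl _ _) (mxrankM_maxr _ _).
Qed.

Lemma rank_gram_eq a b (x : 'I_a -> E) (y : 'I_b -> E) :
  fam_span x = fam_span y -> \rank (gram x x) = \rank (gram y y).
Proof.
move=> xy; apply/eqP; rewrite eqn_leq !rank_gram_le // => i.
  by rewrite xy mem_fam.
by rewrite -xy mem_fam.
Qed.

Definition fam_cat a b (x : 'I_a -> E) (y : 'I_b -> E) (i : 'I_(a + b)) : E :=
  match fintype.split i with inl i1 => x i1 | inr i2 => y i2 end.

Lemma fam_catl a b (x : 'I_a -> E) (y : 'I_b -> E) i :
  fam_cat x y (lshift b i) = x i.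
Proof. by rewrite /fam_cat -[lshift b i]/(unsplit (inl i)) unsplitK. Qed.

Lemma fam_catr a b (x : 'I_a -> E) (y : 'I_b -> E) i :
  fam_cat x y (rshift a i) = y i.
Proof. by rewrite /fam_cat -[rshift a i]/(unsplit (inr i)) unsplitK. Qed.

Lemma fam_span_cat a b (x : 'I_a -> E) (y : 'I_b -> E) :
  fam_span (fam_cat x y) = (fam_span x + fam_span y)%VS.
Proof.
rewrite /fam_span big_split_ord /=; congr (_ + _)%VS; apply: eq_bigr => i _.
  by rewrite fam_catl.
by rewrite fam_catr.
Qed.

Lemma gram_cat a b (x : 'I_a -> E) (y : 'I_b -> E) :
  gram (fam_cat x y) (fam_cat x y) =
    block_mx (gram x x) (gram x y) (gram y x) (gram y y).
Proof.
apply/matrixP => i j; case: (split_ordP i) => i1 ->; case: (split_ordP j) => j1 ->;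
by rewrite ?block_mxEul ?block_mxEur ?block_mxEdl ?block_mxEdr !mxE
  ?fam_catl ?fam_catr.
Qed.

Lemma gram_eq0 a b (x : 'I_a -> E) (y : 'I_b -> E) :
  (forall i j, form (x i) (y j) = 0) -> gram x y = 0.
Proof. by move=> xy; apply/matrixP => i j; rewrite !mxE. Qed.

Lemma rank_gram_orth a b (x : 'I_a -> E) (y : 'I_b -> E) :
    (forall i j, form (x i) (y j) = 0) -> (forall i j, form (y i) (x j) = 0) ->
  \rank (gram (fam_cat x y) (fam_cat x y)) =
    (\rank (gram x x) + \rank (gram y y))%N.
Proof.
by move=> xy yx; rewrite gram_cat (gram_eq0 xy) (gram_eq0 yx) rank_diag_block_mx.
Qed.

(** The Gram matrix is block antidiagonal. The form is an arbitrary bilinear one, so the two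
    off-diagonal blocks are counted separately. *)
Lemma rank_gram_isotropic a b (x : 'I_a -> E) (y : 'I_b -> E) :
    (forall i j, form (x i) (x j) = 0) -> (forall i j, form (y i) (y j) = 0) ->
  \rank (gram (fam_cat x y) (fam_cat x y)) =
    (\rank (gram x y) + \rank (gram y x))%N.
Proof.
move=> xx yy; rewrite gram_cat (gram_eq0 xx) (gram_eq0 yy).
pose P := block_mx 0 1%:M 1%:M 0 : 'M[K]_(a + b, b + a).
have -> : block_mx 0 (gram x y) (gram y x) 0 =
    block_mx (gram x y) 0 0 (gram y x) *m (block_mx 0 1%:M 1%:M 0 : 'M[K]_(b + a, a + b)).
  by rewrite mulmx_block !mulmx0 !mul0mx !mulmx1 !add0r !addr0.
rewrite mxrankMfree ?rank_diag_block_mx //; apply/row_freeP; exists P.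
by rewrite mulmx_block !mulmx0 !mulmx1 !add0r !addr0 -scalar_mx_block.
Qed.

End GramRank.

(** * Spans of isotropic frames *)

Section IsotropicSpan.

Variable K : fieldType.

Lemma wedge_mull k n (U : 'M[K]_k) (B : 'M[K]_(k, n)) :
  wedge (U *m B) = \det U *: wedge B.
Proof.
apply/ffunP => f; rewrite !ffunE -[LHS]/(\det _) -[RHS]/(_ * _) -det_mulmx.
by congr (\det _); rewrite -mulmx_colsub.
Qed.

Lemma wedge_eq0 k n (B : 'M[K]_(k, n)) : ~~ row_free B -> wedge B = 0.
Proof.
rewrite -kermx_eq0 => /rowV0Pn[u /sub_kermxP uB u0]; apply/ffunP => f.
rewrite !ffunE; apply/eqP/det0P; exists u => //.
by rewrite mulmx_colsub uB; apply/matrixP => i j; rewrite !mxE.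
Qed.

Section Pairing.
Variables (n : nat) (J : 'M[K]_n) (k : nat).

Definition pairing (x y : ext K k n) : K :=
  ext_lift (fun A => ext_lift (fun B => \det (A *m J *m B^T) : K^o) y) x.

Lemma det_form_altr (A : 'M[K]_(k, n)) :
  alternating (fun B : 'M[K]_(k, n) => \det (A *m J *m B^T) : K^o).
Proof.
suff -> : (fun B : 'M[K]_(k, n) => \det (A *m J *m B^T) : K^o) =
    (fun B => \det (B *m (A *m J)^T) : K^o).
  exact: alt_mulmxr (@det_alternating K k).
by apply/funext => B; rewrite -[in RHS]det_tr trmx_mul trmxK.
Qed.

Lemma det_form_altl (B : 'M[K]_(k, n)) :
  alternating (fun A : 'M[K]_(k, n) => \det (A *m J *m B^T) : K^o).
Proof.
suff -> : (fun A : 'M[K]_(k, n) => \det (A *m J *m B^T) : K^o) =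
    (fun A => \det (A *m (J *m B^T)) : K^o).
  exact: alt_mulmxr (@det_alternating K k).
by apply/funext => A; rewrite mulmxA.
Qed.

Lemma pairing_wedgel A y :
  pairing (wedge A) y = ext_lift (fun B => \det (A *m J *m B^T) : K^o) y.
Proof.
rewrite /pairing ext_lift_wedge //; rewrite /ext_lift.
by apply: alt_sum => f; apply: altZ; apply: det_form_altl.
Qed.

Lemma pairing_wedge A B : pairing (wedge A) (wedge B) = \det (A *m J *m B^T).
Proof. by rewrite pairing_wedgel ext_lift_wedge //; apply: det_form_altr. Qed.

Lemma pairing_linl a x y z : pairing (a *: x + y) z = a * pairing x z + pairing y z.
Proof. by rewrite /pairing linearP. Qed.

Lemma pairing_linr a x y z : pairing z (a *: x + y) = a * pairing z x + pairing z y.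
Proof.
pose L f w : K^o :=
  ext_lift (fun B => \det (rowsub (val (f : multiindex k n)) 1%:M *m J *m B^T) : K^o) w.
have pE w : pairing z w = \sum_f z f * L f w by [].
rewrite !pE mulr_sumr -big_split; apply: eq_bigr => f _ /=.
by rewrite /L linearP mulrDr mulrCA.
Qed.

Definition isotropic (B : 'M[K]_(k, n)) : Prop := B *m J *m B^T = 0.

(** Over an infinite field there may be infinitely many isotropic frames; a finite family whose span
    has maximal dimension already absorbs all others. *)
Lemma iso_frames_exist : exists a (B : 'I_a -> 'M[K]_(k, n)),
  (forall i, isotropic (B i)) /\
  (forall C, isotropic C -> wedge C \in fam_span (fun i => wedge (B i))).
Proof.
pose P d := `[< exists a (B : 'I_a -> 'M[K]_(k, n)),
  (forall i, isotropic (B i)) /\ \dim (fam_span (fun i => wedge (B i))) = d >].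
have exP : exists d, P d.
  exists (\dim (fam_span (fun i : 'I_0 => wedge (0 : 'M[K]_(k, n))))).
  by apply/asboolP; exists 0%N, (fun=> 0); split=> // -[].
have ubP d : P d -> (d <= \dim {:ext K k n})%N.
  by move=> /asboolP[a [B [_ <-]]]; rewrite dimvS // subvf.
case: (ex_maxnP exP ubP) => d /asboolP[a [B [isoB dB]]] Bmax.
exists a, B; split=> // C isoC.
pose B' (i : 'I_(a + 1)) := match fintype.split i with inl j => B j | inr _ => C end.
have eB' : (fun i => wedge (B' i)) = fam_cat (fun i => wedge (B i)) (fun _ : 'I_1 => wedge C).
  by apply/funext => i; rewrite /B' /fam_cat; case: fintype.split.
have sub : (fam_span (fun i => wedge (B i)) <= fam_span (fun i => wedge (B' i)))%VS.
  by rewrite eB' fam_span_cat addvSl.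
have -> : fam_span (fun i => wedge (B i)) = fam_span (fun i => wedge (B' i)).
  apply/eqP; rewrite eqEdim sub dB Bmax //; apply/asboolP.
  exists (a + 1)%N, B'; split=> // i; rewrite /B'.
  by case: fintype.split.
by rewrite eB' fam_span_cat (subvP (addvSr _ _)) // (mem_fam _ ord0).
Qed.

Definition iso_frames_size : nat := projT1 (cid iso_frames_exist).
Definition iso_frames : 'I_iso_frames_size -> 'M[K]_(k, n) :=
  projT1 (cid (projT2 (cid iso_frames_exist))).

Definition iso_span : {vspace ext K k n} :=
  fam_span (fun i => wedge (iso_frames i)).

Lemma iso_framesP i : isotropic (iso_frames i).
Proof. exact: (projT2 (cid (projT2 (cid iso_frames_exist)))).1. Qed.

Lemma mem_iso_span C : isotropic C -> wedge C \in iso_span.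
Proof. exact: (projT2 (cid (projT2 (cid iso_frames_exist)))).2. Qed.

Lemma iso_span_sub (U : {vspace ext K k n}) :
  (forall C, isotropic C -> wedge C \in U) -> (iso_span <= U)%VS.
Proof. by move=> isoU; apply: fam_span_sub => i; apply/isoU/iso_framesP. Qed.

Definition iso_rank : nat :=
  \rank (gram pairing (fun i => wedge (iso_frames i)) (fun i => wedge (iso_frames i))).

Lemma iso_rank_fam a (x : 'I_a -> ext K k n) :
  fam_span x = iso_span -> \rank (gram pairing x x) = iso_rank.
Proof. exact: rank_gram_eq pairing_linl pairing_linr _ _ _ _. Qed.

Lemma iso_rank_ge a (x : 'I_a -> ext K k n) :
  (forall i, x i \in iso_span) -> (\rank (gram pairing x x) <= iso_rank)%N.
Proof. exact: rank_gram_le pairing_linl pairing_linr _ _ _ _. Qed.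

End Pairing.

Lemma iso_rank_congr_le n n' (J : 'M[K]_n) (J' : 'M[K]_n') (A : 'M[K]_(n', n)) k :
  A *m J *m A^T = J' -> (iso_rank J' k <= iso_rank J k)%N.
Proof.
move=> AJ.
have fE (B C : 'M[K]_(k, n')) : B *m J' *m C^T = B *m A *m J *m (C *m A)^T.
  by rewrite -AJ trmx_mul !mulmxA.
have := @iso_rank_ge n J k _ (fun i => wedge (@iso_frames n' J' k i *m A)).
have -> : gram (pairing J (k := k)) (fun i => wedge (@iso_frames n' J' k i *m A))
     (fun i => wedge (@iso_frames n' J' k i *m A)) =
   gram (pairing J' (k := k)) (fun i => wedge (@iso_frames n' J' k i))
     (fun i => wedge (@iso_frames n' J' k i)).
  by apply/matrixP => i j; rewrite !mxE !pairing_wedge fE.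
apply=> i; apply: mem_iso_span; rewrite /isotropic -fE; exact: iso_framesP.
Qed.

Lemma iso_rank0 n (J : 'M[K]_n) : iso_rank J 0 = 1%N.
Proof.
have iso0 (C : 'M[K]_(0, n)) : isotropic J C by apply/matrixP => -[].
rewrite -(@iso_rank_fam n J 0 1 (fun=> wedge 0)).
  rewrite (_ : gram _ _ _ = 1%:M) ?mxrank1 //; apply/matrixP => i j.
  by rewrite !mxE pairing_wedge det_mx00 !ord1.
apply/eqP; rewrite eqEsubv; apply/andP; split.
  by apply: fam_span_sub => _; apply: mem_iso_span.
apply: iso_span_sub => C _; rewrite (_ : C = 0); last by apply/matrixP => -[].
exact: mem_fam ord0.
Qed.

(** For an alternate form every vector is isotropic, so the span is the whole space and the Gram
    matrix of the standard basis is [J]. *)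
Lemma iso_rank1 n (J : 'M[K]_n) :
  (forall v : 'rV_n, v *m J *m v^T = 0) -> iso_rank J 1 = \rank J.
Proof.
move=> altJ.
rewrite -(@iso_rank_fam n J 1 n (fun i => wedge (delta_mx 0 i))).
  congr (\rank _); apply/matrixP => i j; rewrite mxE pairing_wedge det_mx11.
  by rewrite -rowE trmx_delta -colE !mxE.
apply/eqP; rewrite eqEsubv; apply/andP; split.
  by apply: fam_span_sub => i; apply: mem_iso_span; apply: altJ.
apply: iso_span_sub => C _; have aw := @wedge_alternating K 1 n.
rewrite -(set_row_id ord0 C) [row _ C]row_sum_delta (alt_set_row_sum _ _ _ _ aw).
apply: memv_suml => i _; apply: memvZ.
rewrite (_ : set_row _ _ _ = delta_mx 0 i); first exact: mem_fam.
by apply/row_matrixP => j; rewrite !ord1 row_set_row; apply/rowP => c; rewrite !mxE.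
Qed.

(** An isotropic subspace has at most half the dimension, so longer isotropic frames are dependent
    and have zero wedge. *)
Lemma iso_rank_eq0 n (J : 'M[K]_n) k :
  J \in unitmx -> (n < k + k)%N -> iso_rank J k = 0%N.
Proof.
move=> Ju nk; rewrite /iso_rank (_ : gram _ _ _ = 0) ?mxrank0 //.
apply: gram_eq0 => i j; rewrite wedge_eq0.
  by rewrite /pairing linear0.
apply: contraL nk => fr; rewrite -leqNgt.
have := mulmx0_rank_max (iso_framesP i).
by rewrite mxrank_tr mxrankMfree ?row_free_unit // (eqP fr).
Qed.

End IsotropicSpan.

(** * Symplectic bases *)

Section SymplecticBases.

Variable K : fieldType.

Definition alternate_mx n (J : 'M[K]_n) : Prop := forall v : 'rV_n, v *m J *m v^T = 0.

Lemma alternate_tr n (J : 'M[K]_n) : alternate_mx J -> J^T = - J.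
Proof.
move=> altJ; apply/matrixP => i j; rewrite !mxE.
pose d (r : 'I_n) : 'rV[K]_n := delta_mx 0 r.
have dE r s : (d r *m J *m (d s)^T) 0 0 = J r s.
  by rewrite -rowE trmx_delta -colE !mxE.
have J0 r : J r r = 0 by rewrite -dE altJ mxE.
have := altJ (d i + d j); move/matrixP/(_ 0 0).
rewrite linearD /= !mulmxDl !mulmxDr !altJ add0r addr0.
by rewrite mxE !dE mxE => /eqP; rewrite addrC addr_eq0 => /eqP.
Qed.

Lemma alternate_congr n n' (J : 'M[K]_n) (M : 'M[K]_(n', n)) :
  alternate_mx J -> alternate_mx (M *m J *m M^T).
Proof.
by move=> altJ v; have := altJ (v *m M); rewrite trmx_mul !mulmxA.
Qed.

Lemma orth_sym n (J : 'M[K]_n) a b (X : 'M[K]_(a, n)) (Y : 'M[K]_(b, n)) :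
  alternate_mx J -> Y *m J *m X^T = - (X *m J *m Y^T)^T.
Proof.
move=> altJ; rewrite !trmx_mul trmxK alternate_tr // mulNmx mulmxN opprK.
by rewrite mulmxA.
Qed.

Lemma orth_sym0 n (J : 'M[K]_n) a b (X : 'M[K]_(a, n)) (Y : 'M[K]_(b, n)) :
  alternate_mx J -> X *m J *m Y^T = 0 -> Y *m J *m X^T = 0.
Proof. by move=> altJ XY; rewrite orth_sym // XY trmx0 oppr0. Qed.

(** [M] is a basis of the kernel of the pairing with [X]. It is nondegenerate because a vector
    orthogonal to both [M] and [X] is orthogonal to their sum, which is everything. *)
Lemma orth_complement n t (J : 'M[K]_n) (X : 'M[K]_(t, n)) :
    alternate_mx J -> J \in unitmx -> X *m J *m X^T \in unitmx ->
  exists n' (M : 'M[K]_(n', n)), [/\ n = (t + n')%N, M *m J *m X^T = 0,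
    M *m J *m M^T \in unitmx &
    forall m (Z : 'M[K]_(m, n)), Z *m J *m X^T = 0 -> exists D, Z = D *m M].
Proof.
move=> altJ Ju Su; set S := X *m J *m X^T in Su; pose H := J *m X^T.
have rH : \rank H = t.
  apply/eqP; rewrite eqn_leq rank_leq_col /=.
  by rewrite -{1}(mxrank_unit Su) /S -mulmxA mxrankM_maxr.
pose M := row_base (kermx H).
have MX : M *m J *m X^T = 0.
  by rewrite -mulmxA; apply/sub_kermxP; rewrite eq_row_base.
have fac m (Z : 'M[K]_(m, n)) : Z *m J *m X^T = 0 -> exists D, Z = D *m M.
  move=> ZX; apply/submxP; rewrite eq_row_base; apply/sub_kermxP.
  by rewrite mulmxA.
have Mfree : row_free M by rewrite row_base_free.
exists (\rank (kermx H)), M; split=> //.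
  by rewrite mxrank_ker rH subnKC // -rH rank_leq_row.
clearbody M; rewrite -row_free_unit -kermx_eq0; apply/eqP/row_matrixP => i; rewrite row0.
set u := row i _; pose w := u *m M.
have wM : w *m J *m M^T = 0.
  by rewrite /w /u -!mulmxA !mulmxA -!row_mul -!mulmxA mulmxA mulmx_ker row0.
have wX : w *m J *m X^T = 0 by rewrite /w -!mulmxA (mulmxA M) MX mulmx0.
suff w0 : w = 0.
  by apply: (row_free_inj Mfree); rewrite -/w w0 mul0mx.
suff wJ : w *m J = 0 by rewrite -(mulmxK Ju w) wJ mul0mx.
rewrite -[w *m J]mulmx1.
(* The rows of [V] are the projections of the standard basis vectors along [X]; being orthogonal to
   [X], they are combinations of the rows of [M]. *)
pose V := 1%:M - H *m invmx S *m X : 'M[K]_n.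
have [D VD] : exists D, V = D *m M.
  apply: fac; rewrite -mulmxA -/H mulmxBl mul1mx -!mulmxA [X *m H]mulmxA -/S.
  by rewrite mulVmx // mulmx1 subrr.
have -> : 1%:M = (V + H *m invmx S *m X)^T by rewrite subrK trmx1.
by rewrite linearD /= mulmxDr VD !trmx_mul !mulmxA wM wX !mul0mx addr0.
Qed.

Definition darboux n (J : 'M[K]_n) t (X Y : 'M[K]_(t, n)) : Prop :=
  [/\ X *m J *m X^T = 0, Y *m J *m Y^T = 0 & X *m J *m Y^T = 1%:M].

Lemma darboux_gram n (J : 'M[K]_n) t (X Y : 'M[K]_(t, n)) :
  alternate_mx J -> darboux J X Y ->
  col_mx X Y *m J *m (col_mx X Y)^T = sympl_form K t.
Proof.
move=> altJ [XX YY XY]; rewrite mul_col_mx tr_col_mx mul_col_row XX XY YY.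
by rewrite orth_sym // XY trmx1.
Qed.

Lemma mulmx1C_eq m n (A : 'M[K]_(m, n)) (B : 'M[K]_(n, m)) :
  n = m -> A *m B = 1%:M -> B *m A = 1%:M.
Proof. by move=> nm; move: A B; rewrite nm => A B; apply: mulmx1C. Qed.

Lemma sympl_form_sq g : sympl_form K g *m sympl_form K g = - 1%:M.
Proof.
rewrite /sympl_form mulmx_block !mul0mx !mulmx0 !mulmx1 !add0r !addr0 mul1mx.
by rewrite (scalar_mx_block g g) opp_block_mx !oppr0.
Qed.

Lemma sympl_form_unit g : sympl_form K g \in unitmx.
Proof.
have := sympl_form_sq g; move/(congr1 -%R); rewrite opprK -mulmxN.
by move/mulmx1_unit => [].
Qed.

Lemma sympl_form_alternate g : alternate_mx (sympl_form K g).
Proof.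
move=> v; rewrite -(hsubmxK v) mul_row_block !mulmx0 mulmxN !mulmx1 add0r addr0.
rewrite tr_row_mx mul_row_col mulNmx.
rewrite (_ : lsubmx v *m _ = (rsubmx v *m (lsubmx v)^T)^T).
  by apply/matrixP => i j; rewrite !ord1 !mxE addNr.
by rewrite trmx_mul trmxK.
Qed.

Lemma darboux_cons n (J : 'M[K]_n) n' (M : 'M[K]_(n', n)) t (X Y : 'M[K]_(t, n'))
    (x y : 'rV[K]_n) :
  alternate_mx J -> x *m J *m y^T = 1%:M ->
  M *m J *m x^T = 0 -> M *m J *m y^T = 0 ->
  darboux (M *m J *m M^T) X Y ->
  darboux J (col_mx x (X *m M)) (col_mx y (Y *m M)).
Proof.
move=> altJ xy Mx My [XX YY XY].
have orth (z : 'rV_n) s (Z : 'M[K]_(s, n')) :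
    M *m J *m z^T = 0 -> Z *m M *m J *m z^T = 0.
  by move=> Mz; rewrite -!mulmxA (mulmxA M) Mz mulmx0.
have gramM s (Z W : 'M[K]_(s, n')) :
    Z *m M *m J *m (W *m M)^T = Z *m (M *m J *m M^T) *m W^T.
  by rewrite trmx_mul !mulmxA.
split; rewrite mul_col_mx tr_col_mx mul_col_row gramM ?XX ?YY ?XY.
- by rewrite altJ orth // (orth_sym0 altJ) ?orth // block_mx0.
- by rewrite altJ orth // (orth_sym0 altJ) ?orth // block_mx0.
- by rewrite xy orth // (orth_sym0 altJ) ?orth // -scalar_mx_block.
Qed.

Lemma hyperbolic_complement n (J : 'M[K]_n) (x y : 'rV[K]_n) :
    alternate_mx J -> J \in unitmx -> x *m J *m y^T = 1%:M ->
  exists n' (M : 'M[K]_(n', n)), [/\ n = n'.+2, M *m J *m x^T = 0,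
    M *m J *m y^T = 0, M *m J *m M^T \in unitmx &
    forall m (Z : 'M[K]_(m, n)), Z *m J *m x^T = 0 -> Z *m J *m y^T = 0 ->
      exists D, Z = D *m M].
Proof.
move=> altJ Ju xy.
have S : col_mx x y *m J *m (col_mx x y)^T \in unitmx.
  by rewrite darboux_gram ?sympl_form_unit //; split.
have [n' [M [nE MX Mu fac]]] := orth_complement altJ Ju S.
have MX' m (Z : 'M[K]_(m, n)) :
  Z *m J *m (col_mx x y)^T = row_mx (Z *m J *m x^T) (Z *m J *m y^T).
  by rewrite tr_col_mx mul_mx_row.
move: MX; rewrite MX' -row_mx0 => /eq_row_mx [Mx My].
exists n', M; split=> // m Z Zx Zy; apply: fac.
by rewrite MX' Zx Zy row_mx0.
Qed.

Lemma col_mx0rows m n (B : 'M[K]_(0, n)) (P : 'M[K]_(m, n)) : col_mx B P = P.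
Proof.
apply/matrixP => i j; rewrite mxE; case: splitP => [[]//|r /= ir].
by congr (P _ _); apply/val_inj.
Qed.

(** Witt extension by induction on the dimension: give the first vector a dual partner orthogonal to
    the other ones, and continue in the complement of the plane they span, which contains the rest
    of the frame. *)
Lemma darboux_extend n (J : 'M[K]_n) l (B : 'M[K]_(l, n)) :
    alternate_mx J -> J \in unitmx -> row_free B -> isotropic J B ->
  exists s (P : 'M[K]_(s, n)) (Y : 'M[K]_(l + s, n)),
    n = ((l + s) + (l + s))%N /\ darboux J (col_mx B P) Y.
Proof.
elim/ltn_ind: n J l B => n IH J l B altJ Ju Bfree isoB.
have step l' (C : 'M[K]_(1 + l', n)) : row_free C -> isotropic J C ->
  exists s (P : 'M[K]_(s, n)) (Y : 'M[K]_(1 + l' + s, n)),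
    n = ((1 + l' + s) + (1 + l' + s))%N /\ darboux J (col_mx C P) Y.
  move=> Cfree isoC.
  have /row_freeP[R CR] : row_free (C *m J) by rewrite /row_free mxrankMfree ?row_free_unit.
  (* The first column of a right inverse of [C *m J] pairs to 1 with the first row of [C] and to 0
     with the others. *)
  set x := usubmx C; set C' := dsubmx C; pose y := (lsubmx R)^T.
  have Cxy : C *m J *m y^T = col_mx 1%:M 0.
    by rewrite trmxK mulmx_lsub CR (scalar_mx_block 1 l') block_mxEh row_mxKl.
  have CE : C = col_mx x C' by rewrite vsubmxK.
  move: Cxy; rewrite {1}CE !mul_col_mx => /eq_col_mx[xy C'y].
  have C'x : C' *m J *m x^T = 0.
    move: isoC; rewrite /isotropic CE mul_col_mx tr_col_mx mul_col_row.
    by rewrite -block_mx0 => /eq_block_mx[].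
  have [n' [M [nE Mx My Mu fac]]] := hyperbolic_complement altJ Ju xy.
  have [D DM] := fac _ _ C'x C'y.
  have altM := alternate_congr M altJ.
  have Dfree : row_free D.
    rewrite /row_free eqn_leq rank_leq_row.
    have C'free : row_free C'.
      apply: inj_row_free => v vC'.
      have vC : (row_mx 0 v : 'rV_(1 + l')) *m C = 0 *m C.
        by rewrite CE mul_row_col !mul0mx vC' addr0.
      have /(congr1 rsubmx) := row_free_inj Cfree vC.
      by rewrite row_mxKr linear0.
    by rewrite -{1}(eqP C'free) DM mxrankM_maxl.
  have isoD : isotropic (M *m J *m M^T) D.
    move: isoC; rewrite /isotropic CE mul_col_mx tr_col_mx mul_col_row.
    by rewrite -block_mx0 => /eq_block_mx[_ _ _]; rewrite DM trmx_mul !mulmxA.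
  have lt : (n' < n)%N by rewrite nE.
  have [s [P [Y [n'E dY]]]] := IH _ lt _ _ _ altM Mu Dfree isoD.
  exists s, (P *m M), (col_mx y (Y *m M)); split.
    by rewrite nE n'E !addnS !addSn.
  have -> : col_mx C (P *m M) = col_mx x (col_mx D P *m M) :> 'M[K]_(1 + (l' + s), n).
    by rewrite mul_col_mx -DM CE col_mxA castmx_id.
  exact: darboux_cons.
case: l B Bfree isoB => [|l] B Bfree isoB; last exact: (step l).
have [n0|n_gt0] := posnP n.
  subst n; exists 0%N, 0, 0; split=> //.
  by split; apply/matrixP => -[].
case: n J altJ Ju IH step B Bfree isoB n_gt0 => // n J altJ Ju _ step B _ _ _.
(* For an empty frame in positive dimension, any nonzero vector is isotropic and starts the process;
   it then becomes part of [P]. *)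
pose x : 'M[K]_(1 + 0, n.+1) := delta_mx 0 0.
have xfree : row_free x by rewrite /row_free mxrank_delta.
have [s [P [Y [nE dY]]]] := step 0%N x xfree (altJ _).
exists s.+1, (col_mx x P), Y; split=> //.
by rewrite col_mx0rows.
Qed.

Section Contraction.
Variables (U : lmodType K) (n : nat).

Definition bilinear_map (psi : 'rV[K]_n -> 'rV[K]_n -> U) : Prop :=
  (forall a u v w, psi (a *: u + v) w = a *: psi u w + psi v w) /\
  (forall a u v w, psi w (a *: u + v) = a *: psi w u + psi w v).

(** The linear map induced by [psi] on the tensor square, evaluated at the tensor [M]. With
    [M = invmx J] this inserts a multiple of the bivector of the form without choosing a symplectic
    basis. *)
Definition contr (M : 'M[K]_n) (psi : 'rV[K]_n -> 'rV[K]_n -> U) : U :=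
  \sum_i \sum_j M i j *: psi (delta_mx 0 i) (delta_mx 0 j).

Lemma bilinear_suml psi (I : finType) (c : I -> K) (u : I -> 'rV_n) w :
  bilinear_map psi -> psi (\sum_i c i *: u i) w = \sum_i c i *: psi (u i) w.
Proof.
case=> bl _; have psi0 : psi 0 w = 0.
  by have := bl (-1) 0 0 w; rewrite scaler0 addr0 scaleN1r addNr.
apply: (big_ind2 (fun u v => psi u w = v)) => // [u1 v1 u2 v2 <- <-|i _].
  by rewrite -[u1]scale1r bl !scale1r.
by rewrite -[_ *: _]addr0 bl psi0 addr0.
Qed.

Lemma bilinear_sumr psi (I : finType) (c : I -> K) (u : I -> 'rV_n) w :
  bilinear_map psi -> psi w (\sum_i c i *: u i) = \sum_i c i *: psi w (u i).
Proof.
case=> _ br; have psi0 : psi w 0 = 0.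
  by have := br (-1) 0 0 w; rewrite scaler0 addr0 scaleN1r addNr.
apply: (big_ind2 (fun u v => psi w u = v)) => // [u1 v1 u2 v2 <- <-|i _].
  by rewrite -[u1]scale1r br !scale1r.
by rewrite -[_ *: _]addr0 br psi0 addr0.
Qed.

Lemma contr_rows t (A : 'M[K]_(t, n)) (S : 'M[K]_t) psi : bilinear_map psi ->
  contr (A^T *m S *m A) psi = \sum_a \sum_b S a b *: psi (row a A) (row b A).
Proof.
move=> bpsi.
have rowE a : row a A = \sum_i A a i *: delta_mx 0 i.
  by rewrite [row a A]row_sum_delta; apply: eq_bigr => i _; rewrite mxE.
under [RHS]eq_bigr => a _ do under eq_bigr => b _ do
  rewrite !rowE (bilinear_suml _ _ _ bpsi).
rewrite /contr.
transitivity (\sum_i \sum_j \sum_a \sum_b (A a i * S a b * A b j) *: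
    psi (delta_mx 0 i) (delta_mx 0 j)).
  apply: eq_bigr => i _; apply: eq_bigr => j _; rewrite mxE scaler_suml.
  rewrite exchange_big; apply: eq_bigr => b _; rewrite mxE mulr_suml scaler_suml.
  by apply: eq_bigr => a _; rewrite mxE.
transitivity (\sum_i \sum_a \sum_j \sum_b (A a i * S a b * A b j) *:
    psi (delta_mx 0 i) (delta_mx 0 j)).
  by apply: eq_bigr => i _; rewrite exchange_big.
rewrite exchange_big; apply: eq_bigr => a _.
transitivity (\sum_i \sum_b \sum_j (A a i * S a b * A b j) *:
    psi (delta_mx 0 i) (delta_mx 0 j)).
  by apply: eq_bigr => i _; rewrite exchange_big.
rewrite exchange_big; apply: eq_bigr => b _; rewrite scaler_sumr.
apply: eq_bigr => i _; rewrite (bilinear_sumr _ _ _ bpsi) !scaler_sumr.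
by apply: eq_bigr => j _; rewrite !scalerA; congr (_ *: _); ring.
Qed.

Lemma contrD M N psi : contr (M + N) psi = contr M psi + contr N psi.
Proof.
rewrite /contr -big_split; apply: eq_bigr => i _; rewrite -big_split.
by apply: eq_bigr => j _; rewrite mxE scalerDl.
Qed.

Lemma contr0 psi : contr 0 psi = 0.
Proof.
by rewrite /contr big1 // => i _; rewrite big1 // => j _; rewrite mxE scale0r.
Qed.

Lemma bilinear_skew psi u v : bilinear_map psi -> (forall w, psi w w = 0) ->
  psi v u = - psi u v.
Proof.
move=> [bl br] alt.
have blD a b w : psi (a + b) w = psi a w + psi b w.
  by rewrite -[a]scale1r bl !scale1r.
have brD a b w : psi w (a + b) = psi w a + psi w b.
  by rewrite -[a]scale1r br !scale1r.
have := alt (u + v); rewrite blD !brD !alt add0r addr0.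
by move/eqP; rewrite addrC addr_eq0 => /eqP.
Qed.

(** If the rows of A form a symplectic basis, then J^-1 = A^T (-S) A with S the standard form. So
    the contraction is -2 times the sum over the pairs of any symplectic basis, which can then be
    adapted to the situation. *)
Lemma contr_darboux (J : 'M[K]_n) t (X Y : 'M[K]_(t, n)) psi :
    alternate_mx J -> J \in unitmx -> n = (t + t)%N -> darboux J X Y ->
    bilinear_map psi -> (forall w, psi w w = 0) ->
  contr (invmx J) psi = - (\sum_i psi (row i X) (row i Y)) *+ 2.
Proof.
move=> altJ Ju nE dXY bpsi alt.
have g := darboux_gram altJ dXY; set A := col_mx X Y in g.
have SV : sympl_form K t *m - sympl_form K t = 1%:M.
  by rewrite mulmxN sympl_form_sq opprK.
have AJ : A *m (J *m A^T *m - sympl_form K t) = 1%:M by rewrite !mulmxA g SV.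
have JA : (J *m A^T *m - sympl_form K t) *m A = 1%:M.
  exact: (mulmx1C_eq nE AJ).
have -> : invmx J = A^T *m (- sympl_form K t) *m A.
  rewrite -[RHS](mulKmx Ju) (_ : J *m _ = 1%:M) ?mulmx1 //.
  by rewrite -JA !mulmxA.
rewrite contr_rows // big_split_ord /= -sumrN -sumrMnl.
have S0 (a b : 'I_(t + t)) : (- sympl_form K t) a b = - sympl_form K t a b by rewrite mxE.
rewrite (eq_bigr (fun i => - psi (row i X) (row i Y))); last first.
  move=> i _; rewrite big_split_ord /= big1 ?add0r => [|j _]; last first.
    by rewrite S0 block_mxEul mxE oppr0 scale0r.
  rewrite (bigD1 i) //= big1 => [|j ji]; rewrite S0 block_mxEur mxE ?eqxx.
    by rewrite addr0 scaleN1r rowKu rowKd.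
  by rewrite eq_sym (negbTE ji) oppr0 scale0r.
rewrite [X in _ + X](eq_bigr (fun i => - psi (row i X) (row i Y))).
  by rewrite -big_split; apply: eq_bigr => i _; rewrite mulr2n.
move=> i _; rewrite big_split_ord /= addrC big1 ?add0r => [|j _]; last first.
  by rewrite S0 block_mxEdr mxE oppr0 scale0r.
rewrite (bigD1 i) //= big1 => [|j ji]; rewrite S0 block_mxEdl !mxE ?eqxx.
  by rewrite addr0 opprK scale1r rowKu rowKd bilinear_skew.
by rewrite eq_sym (negbTE ji) oppr0 oppr0 scale0r.
Qed.

End Contraction.

End SymplecticBases.

(** * Adding a hyperbolic plane *)

Section ExtendByHyperbolicPlane.

Variable K : fieldType.

Lemma row0_det k (A : 'M[K]_k) i : row i A = 0 -> \det A = 0.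
Proof.
move=> A0; rewrite (expand_det_row _ i) big1 // => j _.
by move/rowP: A0 => /(_ j); rewrite !mxE => ->; rewrite mul0r.
Qed.

Lemma gram_col_mx n (J : 'M[K]_n) a b c d (A : 'M[K]_(a, n)) (B : 'M[K]_(b, n))
    (C : 'M[K]_(c, n)) (D : 'M[K]_(d, n)) :
  col_mx A B *m J *m (col_mx C D)^T =
  block_mx (A *m J *m C^T) (A *m J *m D^T) (B *m J *m C^T) (B *m J *m D^T).
Proof. by rewrite mul_col_mx tr_col_mx mul_col_row. Qed.

Lemma sympl_form_det g : \det (sympl_form K g) = 1.
Proof.
have -> : sympl_form K g = block_mx 1%:M 1%:M 0 1%:M *m block_mx 1%:M 0 (- 1%:M) 1%:M
    *m block_mx 1%:M 1%:M 0 1%:M.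
  rewrite mulmx_block !mul0mx !mulmx0 !mulmx1 !mul1mx !add0r subrr.
  by rewrite mulmx_block !(mul0mx, mulmx1, add0r) addNr !mulmx0 addr0.
by rewrite !det_mulmx det_lblock !det_ublock !det1 !mulr1.
Qed.

Section Wedge2.
Variables (k n : nat) (U : lmodType K) (phi : 'M[K]_(1 + k, n) -> U).
Hypothesis aphi : alternating phi.

Lemma alt_col_linear B a (u v : 'rV[K]_n) :
  phi (col_mx (a *: u + v) B) = a *: phi (col_mx u B) + phi (col_mx v B).
Proof.
have e w : col_mx w B = set_row (lshift k ord0) w (col_mx 0 B).
  apply/row_matrixP => i; rewrite rowK; case: (split_ordP i) => j ->.
    by rewrite rowKu ord1 eqxx; apply/rowP => c; rewrite mxE.
  by rewrite !rowKd eq_rlshift.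
by rewrite (e (_ + _)) (e u) (e v) -[v in LHS]scale1r alt_set_row // scale1r.
Qed.

Lemma alt_dsub u : alternating (fun B : 'M[K]_(k, n) => phi (col_mx u B)).
Proof.
suff -> : (fun B : 'M[K]_(k, n) => phi (col_mx u B)) =
    (fun B => phi (col_mx u (B *m 1%:M))) by apply: alt_col_mx.
by apply/funext => B; rewrite mulmx1.
Qed.

End Wedge2.

Lemma alt_bilinear k n (U : lmodType K) (phi : 'M[K]_(1 + (1 + k), n) -> U) B :
  alternating phi -> bilinear_map (fun u v => phi (col_mx u (col_mx v B))).
Proof.
move=> aphi; split=> [a u v w|a u v w]; first exact: alt_col_linear.
exact: (alt_col_linear (alt_dsub aphi w)).
Qed.

Lemma alt_diag k n (U : lmodType K) (phi : 'M[K]_(1 + (1 + k), n) -> U) B u :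
  alternating phi -> phi (col_mx u (col_mx u B)) = 0.
Proof.
move=> aphi; apply: (aphi.2 (lshift _ ord0) (rshift 1 (lshift _ ord0))).
  by rewrite eq_lrshift.
by rewrite rowKu rowKd rowKu.
Qed.

Lemma alt_repeat k n (U : lmodType K) (phi : 'M[K]_(1 + (1 + k), n) -> U) B i v :
  alternating phi -> phi (col_mx (row i B) (col_mx v B)) = 0.
Proof.
move=> aphi; apply: (aphi.2 (lshift _ ord0) (rshift 1 (rshift 1 i))).
  by rewrite eq_lrshift.
by rewrite rowKu !rowKd; apply/rowP => c; rewrite !mxE.
Qed.

Definition wedge2 k n (B : 'M[K]_(k, n)) (u v : 'rV[K]_n) : ext K (1 + (1 + k)) n :=
  wedge (col_mx u (col_mx v B)).

Lemma isotropic_col_mx n (J : 'M[K]_n) a b (X : 'M[K]_(a, n)) (B : 'M[K]_(b, n)) :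
  alternate_mx J ->
  isotropic J (col_mx X B) <->
  [/\ isotropic J X, X *m J *m B^T = 0 & isotropic J B].
Proof.
move=> altJ; rewrite /isotropic mul_col_mx tr_col_mx mul_col_row.
split=> [|[-> XB ->]]; last by rewrite XB orth_sym0 // block_mx0.
by rewrite -block_mx0 => /eq_block_mx[].
Qed.

(** Use p /\ q - r /\ s = (p + r) /\ (q - s) + p /\ s - r /\ q: the three planes on the right are
    isotropic, the first because <p + r, q - s> = 1 - 1. *)
Lemma hyperbolic_swap n (J : 'M[K]_n) k (B : 'M[K]_(k, n)) (p q r s : 'rV[K]_n) :
    alternate_mx J -> isotropic J B ->
    p *m J *m q^T = 1%:M -> r *m J *m s^T = 1%:M ->
    p *m J *m r^T = 0 -> p *m J *m s^T = 0 -> q *m J *m r^T = 0 -> q *m J *m s^T = 0 ->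
    p *m J *m B^T = 0 -> q *m J *m B^T = 0 -> r *m J *m B^T = 0 -> s *m J *m B^T = 0 ->
  wedge2 B p q - wedge2 B r s \in iso_span J (1 + (1 + k)).
Proof.
move=> altJ isoB pq rs pr ps qr qs pB qB rB sB.
have sym0 := orth_sym0 altJ.
have [bl br] := alt_bilinear B (@wedge_alternating K (1 + (1 + k)) n).
have -> : wedge2 B p q - wedge2 B r s =
    wedge2 B (p + r) (q - s) + wedge2 B p s - wedge2 B r q.
  have DL u v w : wedge2 B (u + v) w = wedge2 B u w + wedge2 B v w.
    by rewrite -[u]scale1r /wedge2 bl !scale1r.
  have DR u v w : wedge2 B u (v - w) = wedge2 B u v - wedge2 B u w.
    by rewrite addrC -scaleN1r /wedge2 br scaleN1r addrC.
  rewrite DL !DR [_ + _ + wedge2 B p s]addrAC subrK -addrA.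
  by rewrite [wedge2 B r q - _ - _]addrAC subrr add0r.
have mem u v : u *m J *m v^T = 0 -> u *m J *m B^T = 0 -> v *m J *m B^T = 0 ->
    wedge2 B u v \in iso_span J (1 + (1 + k)).
  move=> uv uB vB; apply: mem_iso_span.
  apply/isotropic_col_mx => //; split; rewrite /isotropic ?altJ //.
    by rewrite tr_col_mx mul_mx_row uv uB row_mx0.
  by apply/isotropic_col_mx => //; split.
apply: memvB; first apply: memvD; apply: mem => //.
- rewrite linearB /= mulmxBr !mulmxDl pq rs ps (sym0 _ _ _ _ qr).
  by rewrite addr0 add0r subrr.
- by rewrite !mulmxDl pB rB addr0.
- by rewrite !mulmxBl qB sB subr0.
- exact: sym0.
Qed.

Section Step.

Variables (n : nat) (J : 'M[K]_n).
Hypotheses (altJ : alternate_mx J) (Ju : J \in unitmx).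

Definition add_plane : 'M[K]_(n + (1 + 1)) := block_mx J 0 0 (sympl_form K 1).

Local Notation N := (n + (1 + 1))%N.
Local Notation J' := add_plane.

Definition inl_mx : 'M[K]_(n, N) := row_mx 1%:M 0.
Definition inr_mx : 'M[K]_(1 + 1, N) := row_mx 0 1%:M.
Definition plane_e : 'rV[K]_N := row_mx 0 (row_mx 1%:M 0).
Definition plane_f : 'rV[K]_N := row_mx 0 (row_mx 0 1%:M).

Local Notation I1 := inl_mx.
Local Notation I2 := inr_mx.
Local Notation e := plane_e.
Local Notation f := plane_f.

Lemma mul_inl k (B : 'M[K]_(k, n)) : B *m I1 = row_mx B 0.
Proof. by rewrite mul_mx_row mulmx1 mulmx0. Qed.

Lemma mul_inr k (B : 'M[K]_(k, 1 + 1)) : B *m I2 = row_mx 0 B.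
Proof. by rewrite mul_mx_row mulmx1 mulmx0. Qed.

Lemma add_plane_row a b (X : 'M[K]_(a, n)) X2 (Y : 'M[K]_(b, n)) Y2 :
  row_mx X X2 *m J' *m (row_mx Y Y2)^T =
    X *m J *m Y^T + X2 *m sympl_form K 1 *m Y2^T.
Proof.
by rewrite mul_row_block !mulmx0 add0r addr0 tr_row_mx mul_row_col.
Qed.

Lemma add_plane_alternate : alternate_mx J'.
Proof.
move=> v; rewrite -(hsubmxK v) add_plane_row altJ sympl_form_alternate.
by rewrite addr0.
Qed.

Lemma add_plane_unit : J' \in unitmx.
Proof. by rewrite unitmxE det_ublock unitrM -!unitmxE Ju sympl_form_unit. Qed.

Lemma sympl_form1_row (a b c d : 'M[K]_1) :
  row_mx a b *m sympl_form K 1 *m (row_mx c d)^T = a *m d^T - b *m c^T.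
Proof.
rewrite mul_row_block !mulmx0 add0r addr0 mulmx1 mulmxN mulmx1.
by rewrite tr_row_mx mul_row_col mulNmx addrC.
Qed.

Lemma plane_ee : e *m J' *m e^T = 0.
Proof. exact: add_plane_alternate. Qed.

Lemma plane_ff : f *m J' *m f^T = 0.
Proof. exact: add_plane_alternate. Qed.

Lemma plane_ef : e *m J' *m f^T = 1%:M.
Proof.
rewrite add_plane_row mul0mx mul0mx add0r sympl_form1_row trmx0 mulmx0 subr0.
by rewrite trmx1 mulmx1.
Qed.

Lemma plane_inl k (B : 'M[K]_(k, n)) v2 :
  (row_mx 0 v2 : 'rV_N) *m J' *m (B *m I1)^T = 0.
Proof. by rewrite mul_inl add_plane_row !mul0mx trmx0 mulmx0 addr0. Qed.

Lemma inl_plane k (B : 'M[K]_(k, n)) v2 :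
  B *m I1 *m J' *m (row_mx 0 v2 : 'rV_N)^T = 0.
Proof. exact/(orth_sym0 add_plane_alternate)/plane_inl. Qed.

Lemma inl_inl a b (X : 'M[K]_(a, n)) (Y : 'M[K]_(b, n)) :
  X *m I1 *m J' *m (Y *m I1)^T = X *m J *m Y^T.
Proof. by rewrite !mul_inl add_plane_row trmx0 mulmx0 addr0. Qed.

Lemma isotropic_inl k (B : 'M[K]_(k, n)) : isotropic J B -> isotropic J' (B *m I1).
Proof. by rewrite /isotropic inl_inl. Qed.

Lemma invmx_add_plane :
  invmx J' = I1^T *m invmx J *m I1 + I2^T *m invmx (sympl_form K 1) *m I2.
Proof.
have -> : I1^T *m invmx J *m I1 + I2^T *m invmx (sympl_form K 1) *m I2 =
    block_mx (invmx J) 0 0 (invmx (sympl_form K 1)).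
  rewrite !tr_row_mx !trmx1 !trmx0 -!mulmxA.
  rewrite (mul_mx_row (invmx J)) (mul_mx_row (invmx (sympl_form K 1))) !mul_col_row.
  by rewrite !mulmx0 !mul0mx !mulmx1 !mul1mx add_block_mx !addr0 !add0r.
set Q := block_mx _ _ _ _.
rewrite -[RHS](mulKmx add_plane_unit) (_ : J' *m Q = 1%:M) ?mulmx1 //.
rewrite mulmx_block !mulmx0 !mul0mx !mulmxV ?sympl_form_unit // !addr0 !add0r.
by rewrite -scalar_mx_block.
Qed.

(** The bivector of an orthogonal sum is the sum of the bivectors; the plane contributes e /\ f with
    the factor -2 of [contr_darboux]. *)
Lemma contr_add_plane (U : lmodType K) (psi : 'rV[K]_N -> 'rV[K]_N -> U) :
    bilinear_map psi -> (forall w, psi w w = 0) ->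
  contr (invmx J') psi =
    contr (invmx J) (fun u v => psi (u *m I1) (v *m I1)) - psi e f *+ 2.
Proof.
move=> bpsi alt; rewrite invmx_add_plane contrD !contr_rows //; congr (_ + _).
  rewrite /contr; apply: eq_bigr => i _; apply: eq_bigr => j _.
  by rewrite !rowE.
pose psi2 u v := psi (u *m I2) (v *m I2).
have bpsi2 : bilinear_map psi2.
  by case: bpsi => bl br; split=> a u v w;
    rewrite /psi2 mulmxDl -scalemxAl ?bl ?br.
transitivity (contr (invmx (sympl_form K 1)) psi2).
  rewrite /contr; apply: eq_bigr => i _; apply: eq_bigr => j _.
  by rewrite !rowE.
rewrite (@contr_darboux _ _ _ _ 1 (row_mx 1%:M 0) (row_mx 0 1%:M)) //.
- by rewrite big_ord1 !row_id /psi2 !mul_inr mulNrn.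
- exact: sympl_form_alternate.
- exact: sympl_form_unit.
- split; rewrite sympl_form1_row ?trmx0 ?trmx1 ?mulmx0 ?mul0mx ?mulmx1 ?subr0 //.
- by move=> w; apply: alt.
Qed.

(* The contraction is, up to a scalar, the wedge of the frame B with the bivector
   omega of the form. *)
Lemma contr_isotropic k (B : 'M[K]_(k, N)) (D : 'M[K]_(1 + (1 + k), N)) :
  isotropic J' D ->
  contr (invmx J') (fun u v => pairing J' (wedge2 B u v) (wedge D) : K^o) = 0.
Proof.
(* As a function of u and v the pairing depends only on [u *m H] and [v *m H]. The contraction is
   therefore taken against [H^T *m invmx J' *m H], which is - D J' D^T and vanishes by isotropy. *)
move=> isoD; pose H := J' *m D^T.
pose psi u v := \det (col_mx u (col_mx v (B *m H))) : K^o.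
have bpsi : bilinear_map psi by apply: alt_bilinear; apply: det_alternating.
have H0 : H^T *m invmx J' *m H = 0.
  rewrite /H trmx_mul trmxK (alternate_tr add_plane_alternate) mulmxN !mulNmx.
  by rewrite mulmxK ?add_plane_unit // mulmxA isoD oppr0.
rewrite -(contr0 psi) -H0 contr_rows // /contr.
apply: eq_bigr => i _; apply: eq_bigr => j _; congr (_ *: _).
rewrite pairing_wedge -mulmxA -/H !mul_col_mx -!rowE.
by [].
Qed.

Variables (l : nat) (mu : K).

(* For mu = 1 / (2 (m + 1)) this is omega /\ B / (m + 1) - e /\ f /\ B. *)
Definition contr_frame (B : 'M[K]_(l, n)) : ext K (1 + (1 + l)) N :=
  - mu *: contr (invmx J) (fun u v => wedge2 (B *m I1) (u *m I1) (v *m I1))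
  - wedge2 (B *m I1) e f.

Lemma contr_frame_alternating : alternating contr_frame.
Proof.
have aw : alternating (@wedge K (1 + (1 + l)) N) by apply: wedge_alternating.
have aw2 u v : alternating (fun B : 'M[K]_(l, n) => wedge2 (B *m I1) u v).
  apply: (@alt_mulmxr _ _ _ _ _ (fun B => wedge2 B u v)).
  exact: (alt_dsub (alt_dsub aw u)).
apply: altD; last exact: altN.
by apply: altZ; apply: alt_sum => i; apply: alt_sum => j; apply: altZ.
Qed.

(** By [contr_isotropic] and [contr_add_plane], the contraction over the small space pairs with
    isotropic wedges like twice e /\ f /\ B; weighted by - mu and joined to the term - e /\ f /\ B
    it gives the factor. *)
Lemma pairing_contr_frame (B : 'M[K]_(l, n)) D : isotropic J' D ->
  pairing J' (contr_frame B) (wedge D) =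
    - (mu *+ 2 + 1) * pairing J' (wedge2 (B *m I1) e f) (wedge D).
Proof.
move=> isoD.
pose L (x : ext K (1 + (1 + l)) N) : K^o := pairing J' x (wedge D).
have Llin : linear L by move=> a x y; rewrite /L pairing_linl.
pose Lm : {linear ext K (1 + (1 + l)) N -> K^o} :=
  HB.pack L (GRing.isLinear.Build K _ K^o *:%R L Llin).
pose psi u v : K^o := pairing J' (wedge2 (B *m I1) u v) (wedge D).
have aL : alternating (fun A => pairing J' (wedge A) (wedge D) : K^o).
  rewrite (_ : (fun A => _) = fun A => \det (A *m J' *m D^T) : K^o).
    exact: det_form_altl.
  by apply/funext => A; rewrite pairing_wedge.
have c0 := contr_isotropic (B *m I1) isoD.
rewrite (contr_add_plane (alt_bilinear _ aL) (alt_diag _ ^~ aL)) in c0.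
have Lc : L (contr (invmx J) (fun u v => wedge2 (B *m I1) (u *m I1) (v *m I1))) =
    psi e f *+ 2.
  move/eqP: c0; rewrite subr_eq0 => /eqP <-.
  rewrite -[L]/(Lm : _ -> _) /contr linear_sum; apply: eq_bigr => i _.
  by rewrite linear_sum; apply: eq_bigr => j _; rewrite linearZ.
rewrite -/(L (contr_frame B)) -[L]/(Lm : _ -> _) linearB linearZ /=.
rewrite Lc -/(psi e f) -[_ *: _]/(_ * _) -mulr_natr -[mu *+ 2]mulr_natr.
rewrite -[L (wedge2 _ _ _)]/(psi e f); ring.
Qed.

Lemma pairing_contr_span (B : 'M[K]_(l, n)) y : y \in iso_span J' (1 + (1 + l)) ->
  pairing J' (contr_frame B) y =
    - (mu *+ 2 + 1) * pairing J' (wedge2 (B *m I1) e f) y.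
Proof.
move=> /fam_spanP[c ->].
rewrite !(form_sumr (@pairing_linr _ _ _ _)) mulr_sumr; apply: eq_bigr => i _.
rewrite pairing_contr_frame; last exact: iso_framesP.
exact: mulrCA.
Qed.

Lemma pairing_sym k m (M : 'M[K]_m) (x y : ext K k m) : alternate_mx M ->
  pairing M y x = (-1) ^+ k * pairing M x y.
Proof.
move=> altM.
have w (A B : 'M[K]_(k, m)) : pairing M (wedge B) (wedge A) =
    (-1) ^+ k * pairing M (wedge A) (wedge B).
  rewrite !pairing_wedge orth_sym // -(scaleN1r (_^T)) detZ det_tr.
  by [].
have pE (u v : ext K k m) : pairing M u v =
    \sum_i \sum_j u i * v j * pairing M (basis_ext K i) (basis_ext K j).
  rewrite {1}(ext_basis u) (form_suml (@pairing_linl _ _ _ _)).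
  apply: eq_bigr => i _; rewrite {1}(ext_basis v).
  rewrite (form_sumr (@pairing_linr _ _ _ _)) mulr_sumr.
  by apply: eq_bigr => j _; rewrite mulrA.
rewrite !pE exchange_big mulr_sumr; apply: eq_bigr => i _.
rewrite mulr_sumr; apply: eq_bigr => j _.
by rewrite w; ring.
Qed.

Lemma pairing_plane0 (u : 'rV[K]_(1 + 1)) (A : 'M[K]_(1 + l, n)) (C : 'M[K]_(1 + (1 + l), n)) :
  pairing J' (wedge (col_mx (u *m I2) (A *m I1))) (wedge (C *m I1)) = 0.
Proof.
rewrite pairing_wedge !mul_col_mx (row0_det (i := lshift _ ord0)) // rowKu.
by rewrite mul_inr plane_inl row0.
Qed.

Lemma pairing_plane (v w : 'rV[K]_(1 + 1)) (A C : 'M[K]_(1 + l, n)) :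
  pairing J' (wedge (col_mx (v *m I2) (A *m I1))) (wedge (col_mx (w *m I2) (C *m I1))) =
    (v *m sympl_form K 1 *m w^T) 0 0 * pairing J (wedge A) (wedge C).
Proof.
rewrite !pairing_wedge gram_col_mx inl_inl.
by rewrite !mul_inr plane_inl det_lblock det_mx11 add_plane_row !mul0mx add0r.
Qed.

Lemma wedge2_plane0 (B : 'M[K]_(l, n)) D : e *m J' *m D^T = 0 ->
  pairing J' (wedge2 (B *m I1) e f) (wedge D) = 0.
Proof.
move=> eD; rewrite pairing_wedge !mul_col_mx (row0_det (i := lshift _ ord0)) //.
by rewrite rowKu eD row0.
Qed.

Lemma wedge2_plane_f (B : 'M[K]_(l, n)) D : f *m J' *m D^T = 0 ->
  pairing J' (wedge2 (B *m I1) e f) (wedge D) = 0.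
Proof.
move=> fD; rewrite pairing_wedge !mul_col_mx.
rewrite (row0_det (i := rshift 1 (lshift _ ord0))) //.
by rewrite rowKd rowKu fD row0.
Qed.

Lemma wedge2_plane (B C : 'M[K]_(l, n)) :
  pairing J' (wedge2 (B *m I1) e f) (wedge2 (C *m I1) e f) =
    pairing J (wedge B) (wedge C).
Proof.
rewrite !pairing_wedge.
have colA (D : 'M[K]_(l, n)) : col_mx e (col_mx f (D *m I1)) =
    col_mx (col_mx e f) (D *m I1) :> 'M[K]_(1 + (1 + l), N).
  by rewrite col_mxA castmx_id.
have detE : \det ((col_mx (col_mx e f) (B *m I1) : 'M[K]_((1 + 1) + l, N)) *m J' *m
    (col_mx (col_mx e f) (C *m I1) : 'M[K]_((1 + 1) + l, N))^T) = \det (B *m J *m C^T).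
  rewrite gram_col_mx inl_inl.
  rewrite [X in block_mx _ X _ _](_ : _ = 0); last first.
    by rewrite !mul_col_mx !plane_inl col_mx0.
  rewrite det_lblock [X in \det X * _](_ : _ = sympl_form K 1).
    by rewrite sympl_form_det mul1r.
  rewrite darboux_gram //; first exact: add_plane_alternate.
  by split; [exact: plane_ee|exact: plane_ff|exact: plane_ef].
by rewrite !colA; exact: detE.
Qed.

(** The first argument is replaced by a multiple of e /\ f /\ B, which is legitimate against the
    isotropic span only. Then e is orthogonal to the small space, so of [contr_frame C] just - e /\
    f /\ C contributes. *)
Lemma pairing_contr_contr (B C : 'M[K]_(l, n)) :
  contr_frame C \in iso_span J' (1 + (1 + l)) ->
  pairing J' (contr_frame B) (contr_frame C) =
    (mu *+ 2 + 1) * pairing J (wedge B) (wedge C).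
Proof.
move=> Cin; rewrite pairing_contr_span //; rewrite mulNr -mulrN; congr (_ * _).
rewrite -wedge2_plane; set w := wedge2 (B *m I1) e f.
pose L (x : ext K (1 + (1 + l)) N) : K^o := pairing J' w x.
have Llin : linear L by move=> a x y; rewrite /L pairing_linr.
pose Lm : {linear ext K (1 + (1 + l)) N -> K^o} :=
  HB.pack L (GRing.isLinear.Build K _ K^o *:%R L Llin).
have Lc : L (contr (invmx J) (fun u v => wedge2 (C *m I1) (u *m I1) (v *m I1))) = 0.
  rewrite -[L]/(Lm : _ -> _) /contr linear_sum big1 // => i _.
  rewrite linear_sum big1 // => j _; rewrite linearZ /= /L wedge2_plane0 ?scaler0 //.
  rewrite tr_col_mx mul_mx_row plane_inl tr_col_mx mul_mx_row !plane_inl.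
  by rewrite !row_mx0.
rewrite -/(L (contr_frame C)) -[L]/(Lm : _ -> _) linearB linearZ /= Lc.
by rewrite scaler0 sub0r opprK.
Qed.

End Step.

End ExtendByHyperbolicPlane.

(** * Hyperbolic pairs adapted to an isotropic frame *)

Section HyperbolicPairs.

Variables (K : fieldType) (n : nat) (J : 'M[K]_n).
Hypotheses (altJ : alternate_mx J) (Ju : J \in unitmx).

Definition wedge_contr l (U : lmodType K) (phi : 'M[K]_(1 + (1 + l), n) -> U) B : U :=
  contr (invmx J) (fun u v => phi (col_mx u (col_mx v B))).

(** In a symplectic basis that extends [B], the terms of the bivector containing a row of [B] repeat
    that row in the wedge and vanish; the complementary pairs remain. *)
Lemma adapted_pairs l (B : 'M[K]_(l, n)) : row_free B -> isotropic J B ->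
  exists s (P Q : 'M[K]_(s, n)),
    [/\ n = ((l + s) + (l + s))%N, P *m J *m B^T = 0, Q *m J *m B^T = 0,
      darboux J P Q &
      forall (U : lmodType K) (phi : 'M[K]_(1 + (1 + l), n) -> U), alternating phi ->
        wedge_contr phi B =
          - (\sum_i phi (col_mx (row i P) (col_mx (row i Q) B))) *+ 2].
Proof.
move=> Bfree isoB; have [s [P [Y [nE dY]]]] := darboux_extend altJ Ju Bfree isoB.
exists s, P, (dsubmx Y).
have [XX YY XY] := dY; rewrite -(vsubmxK Y) in YY XY.
move: XX YY XY; rewrite !gram_col_mx -[0 in X in X -> _]block_mx0.
rewrite -[0 in X in _ -> X -> _]block_mx0 (scalar_mx_block l s).
move=> /eq_block_mx[_ _ PB PP] /eq_block_mx[_ _ _ QQ] /eq_block_mx[_ BQ _ PQ].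
split=> //; first exact: orth_sym0.
move=> U phi aphi; rewrite /wedge_contr.
rewrite (contr_darboux altJ Ju nE dY (alt_bilinear _ aphi)); last first.
  by move=> w; apply: alt_diag.
rewrite big_split_ord /= big1 ?add0r => [|i _]; last first.
  by rewrite rowKu; apply: alt_repeat.
by congr (- _ *+ 2); apply: eq_bigr => i _; rewrite rowKd row_dsubmx.
Qed.

(** Here the hyperbolic pair (p, q) is prescribed and [B] is extended inside its complement; the
    count [s.+1] includes this pair. *)
Lemma adapted_pairs_cons l (B : 'M[K]_(l, n)) (p q : 'rV[K]_n) :
  row_free B -> isotropic J B -> p *m J *m q^T = 1%:M ->
  B *m J *m p^T = 0 -> B *m J *m q^T = 0 ->
  exists s (P Q : 'M[K]_(s, n)),
    [/\ n = ((l + s.+1) + (l + s.+1))%N,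
      [/\ P *m J *m B^T = 0, Q *m J *m B^T = 0, P *m J *m p^T = 0,
        Q *m J *m p^T = 0 & P *m J *m q^T = 0 /\ Q *m J *m q^T = 0],
      darboux J P Q &
      forall (U : lmodType K) (phi : 'M[K]_(1 + (1 + l), n) -> U), alternating phi ->
        wedge_contr phi B =
          - (phi (col_mx p (col_mx q B)) +
             \sum_i phi (col_mx (row i P) (col_mx (row i Q) B))) *+ 2].
Proof.
move=> Bfree isoB pq Bp Bq.
have [n' [M [nE Mp Mq Mu fac]]] := hyperbolic_complement altJ Ju pq.
have [D DM] := fac _ _ Bp Bq.
have altM := alternate_congr M altJ.
have Dfree : row_free D.
  by rewrite /row_free eqn_leq rank_leq_row -{1}(eqP Bfree) DM mxrankM_maxl.
have isoD : isotropic (M *m J *m M^T) D.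
  by move: isoB; rewrite /isotropic DM trmx_mul !mulmxA.
have [s [P [Y [n'E dY]]]] := darboux_extend altM Mu Dfree isoD.
have dJ := darboux_cons altJ pq Mp Mq dY.
exists s, (P *m M), (dsubmx Y *m M).
have gramM a b (Z : 'M[K]_(a, n')) (W : 'M[K]_(b, n')) :
    Z *m M *m J *m (W *m M)^T = Z *m (M *m J *m M^T) *m W^T.
  by rewrite trmx_mul !mulmxA.
have orth a (z : 'rV_n) (Z : 'M[K]_(a, n')) :
    M *m J *m z^T = 0 -> Z *m M *m J *m z^T = 0.
  by move=> Mz; rewrite -!mulmxA (mulmxA M) Mz mulmx0.
have [XX YY XY] := dY; rewrite -(vsubmxK Y) in YY XY.
move: XX YY XY; rewrite !gram_col_mx -[0 in X in X -> _]block_mx0.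
rewrite -[0 in X in _ -> X -> _]block_mx0 (scalar_mx_block l s).
move=> /eq_block_mx[_ _ PB PP] /eq_block_mx[_ _ _ QQ] /eq_block_mx[_ BQ _ PQ].
split.
- by rewrite nE n'E !addnS !addSn.
- split; rewrite ?orth // DM gramM //; exact: orth_sym0.
- by split; rewrite gramM.
move=> U phi aphi; rewrite /wedge_contr.
rewrite (contr_darboux (t := 1 + (l + s)) altJ Ju _ dJ (alt_bilinear _ aphi)); first last.
- by move=> w; apply: alt_diag.
- by rewrite nE n'E !addnS !addSn.
rewrite big_split_ord big_ord1 /= !rowKu !row_id.
congr (- (_ + _) *+ 2).
rewrite big_split_ord /= big1 ?add0r => [|i _]; last first.
  by rewrite rowKd row_mul rowKu -row_mul -DM; apply: alt_repeat.
apply: eq_bigr => i _; rewrite !rowKd !row_mul rowKd -row_dsubmx.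
by [].
Qed.

End HyperbolicPairs.

Lemma row_gram (K : fieldType) n (J : 'M[K]_n) a b (P : 'M[K]_(a, n)) (Q : 'M[K]_(b, n)) i j :
  row i P *m J *m (row j Q)^T = ((P *m J *m Q^T) i j)%:M.
Proof.
rewrite -!row_mul; apply/matrixP => x y; rewrite !ord1 !mxE eqxx mulr1n.
by apply: eq_bigr => k _; rewrite !mxE.
Qed.

Lemma row_gramr (K : fieldType) n (J : 'M[K]_n) a b (P : 'M[K]_(a, n)) (Q : 'M[K]_(b, n)) i :
  row i P *m J *m Q^T = row i (P *m J *m Q^T).
Proof. by rewrite !row_mul. Qed.

Lemma bilinear_Zl (K : fieldType) (U : lmodType K) n
    (psi : 'rV[K]_n -> 'rV[K]_n -> U) a u v :
  bilinear_map psi -> psi (a *: u) v = a *: psi u v.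
Proof.
move=> bpsi; have := bilinear_suml (fun _ : 'I_1 => a) (fun=> u) v bpsi.
by rewrite !big_ord1.
Qed.

(** * The recursion for the rank of the form on isotropic spans *)

Section Recursion.

Variables (K : fieldType) (n : nat) (J : 'M[K]_n).
Hypotheses (altJ : alternate_mx J) (Ju : J \in unitmx).
Variables (l m : nat) (mu : K).
(** So [m.+1] hyperbolic pairs complement an independent isotropic frame of length [l], and
    [mu *+ 2] is the weight of each in their average. *)
Hypothesis nE : n = ((l + m.+1) + (l + m.+1))%N.
Hypothesis muE : mu *+ 2 * m.+1%:R = 1.

Local Notation N := (n + (1 + 1))%N.
Local Notation J' := (add_plane J).
Local Notation I1 := (inl_mx K n).
Local Notation I2 := (inr_mx K n).
Local Notation e := (plane_e K n).
Local Notation f := (plane_f K n).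
Local Notation altJ' := (add_plane_alternate altJ).

Lemma ext_lift_span k (U : vectType K) (phi : 'M[K]_(k, n) -> U) x :
  alternating phi -> x \in iso_span J k ->
  ext_lift phi x \in fam_span (fun i => phi (@iso_frames _ _ J k i)).
Proof.
move=> aphi /fam_spanP[c ->]; rewrite linear_sum; apply: memv_suml => i _.
rewrite linearZ /= ext_lift_wedge //.
by apply/memvZ/(mem_fam (fun i => phi (iso_frames i))).
Qed.

Lemma iso_frame_span k (U : vectType K) (phi : 'M[K]_(k, n) -> U) B :
  alternating phi -> isotropic J B ->
  phi B \in fam_span (fun i => phi (@iso_frames _ _ J k i)).
Proof.
move=> aphi isoB; rewrite -(ext_lift_wedge B aphi).
by apply: ext_lift_span => //; apply: mem_iso_span.
Qed.

Let wedge_inl k (A : 'M[K]_(k, n)) : ext K k N := wedge (A *m I1).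

Let wedge_inl_alt k : alternating (@wedge_inl k).
Proof. exact/alt_mulmxr/wedge_alternating. Qed.

Let wedge2_inl (B : 'M[K]_(l, n)) u v :
  wedge2 (B *m I1) (u *m I1) (v *m I1) = wedge_inl (col_mx u (col_mx v B)).
Proof. by rewrite /wedge_inl !mul_col_mx. Qed.

Let contr_frameE (B : 'M[K]_(l, n)) : contr_frame J mu B =
  - mu *: wedge_contr J (@wedge_inl (1 + (1 + l))) B - wedge2 (B *m I1) e f.
Proof.
rewrite /contr_frame /wedge_contr; congr (_ *: contr _ _ - _).
by apply/funext => u; apply/funext => v; apply: wedge2_inl.
Qed.

Lemma contr_frame_mem (B : 'M[K]_(l, n)) : isotropic J B ->
  contr_frame J mu B \in iso_span J' (1 + (1 + l)).
Proof.
move=> isoB; have acf := contr_frame_alternating J l mu.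
(* A dependent frame has zero wedge, hence zero image under every alternating map. *)
have [Bfree|nB] := boolP (row_free B); last first.
  by rewrite -(ext_lift_wedge _ acf) wedge_eq0 // linear0 mem0v.
have [s [P [Q [nE' PB QB [PP QQ PQ] cE]]]] := adapted_pairs altJ Ju Bfree isoB.
have sm : s = m.+1.
  by apply/(@addnI l)/double_inj; rewrite -!addnn -nE' -nE.
subst s.
rewrite contr_frameE cE //; set w := wedge2 _ _ _.
(* Since the [m.+1] weights add up to 1, the term [w] can be distributed over the pairs, leaving
   differences to which [hyperbolic_swap] applies. *)
have -> : - mu *: (- (\sum_i wedge_inl (col_mx (row i P) (col_mx (row i Q) B))) *+ 2)
    - w = \sum_i (mu *+ 2) *: (wedge_inl (col_mx (row i P) (col_mx (row i Q) B)) - w).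
  rewrite -scaler_sumr sumrB sumr_const card_ord [RHS]scalerBr -[w *+ m.+1]scaler_nat.
  rewrite [X in _ = _ - X]scalerA muE scale1r; congr (_ - _).
  by rewrite mulNrn scalerN scaleNr opprK -scalerMnr scalerMnl.
apply: memv_suml => i _; apply: memvZ; rewrite -wedge2_inl.
have sym0 := orth_sym0 altJ'.
have eB u : (row_mx 0 u : 'rV_N) *m J' *m (B *m I1)^T = 0 by apply: plane_inl.
apply: hyperbolic_swap; rewrite ?inl_inl ?row_gram ?row_gramr ?PB ?QB ?PQ ?row0 //.
- exact: altJ'.
- exact: isotropic_inl.
- by rewrite mxE eqxx.
- exact: plane_ef.
- exact: inl_plane.
- exact: inl_plane.
- exact: inl_plane.
- exact: inl_plane.
- exact: plane_inl.
- exact: plane_inl.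
Qed.

Let u_e : 'rV[K]_(1 + 1) := row_mx 1%:M 0.
Let u_f : 'rV[K]_(1 + 1) := row_mx 0 1%:M.

Let wedge_plane (u : 'rV[K]_(1 + 1)) (A : 'M[K]_(1 + l, n)) : ext K (1 + (1 + l)) N :=
  wedge (col_mx (u *m I2) (A *m I1)).

Let wedge_plane_alt u : alternating (wedge_plane u).
Proof. exact/alt_col_mx/wedge_alternating. Qed.

Let fe i : ext K (1 + (1 + l)) N := wedge_plane u_e (@iso_frames _ _ J (1 + l) i).
Let ff i : ext K (1 + (1 + l)) N := wedge_plane u_f (@iso_frames _ _ J (1 + l) i).
Let fb i : ext K (1 + (1 + l)) N := wedge_inl (@iso_frames _ _ J (1 + (1 + l)) i).
Let fc i : ext K (1 + (1 + l)) N := contr_frame J mu (@iso_frames _ _ J l i).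

Let fam := fam_cat (fam_cat fe ff) (fam_cat fb fc).
Let Z := fam_span fam.

Let ZE : Z = (fam_span fe + fam_span ff + (fam_span fb + fam_span fc))%VS.
Proof. by rewrite /Z /fam !fam_span_cat. Qed.

Let Z_e x : x \in fam_span fe -> x \in Z.
Proof. by apply/subvP; rewrite ZE -addvA addvSl. Qed.

Let Z_f x : x \in fam_span ff -> x \in Z.
Proof. by apply/subvP; rewrite ZE (addvC (fam_span fe)) -addvA addvSl. Qed.

Let Z_b x : x \in fam_span fb -> x \in Z.
Proof. by apply/subvP; rewrite ZE addvC -addvA addvSl. Qed.

Let Z_c x : x \in fam_span fc -> x \in Z.
Proof. by apply/subvP; rewrite ZE addvC (addvC (fam_span fb)) -addvA addvSl. Qed.

Let isotropic_plane u (A : 'M[K]_(1 + l, n)) : isotropic J A ->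
  isotropic J' (col_mx (u *m I2) (A *m I1) : 'M[K]_(1 + (1 + l), N)).
Proof.
move=> isoA; apply/(isotropic_col_mx _ _ altJ'); split; first exact: altJ'.
  by rewrite mul_inr plane_inl.
exact: isotropic_inl.
Qed.

Lemma Z_sub : (Z <= iso_span J' (1 + (1 + l)))%VS.
Proof.
rewrite ZE !subv_add; apply/andP; split; apply/andP; split;
  apply: fam_span_sub => i; have iso := iso_framesP i.
- exact/mem_iso_span/isotropic_plane.
- exact/mem_iso_span/isotropic_plane.
- exact/mem_iso_span/isotropic_inl.
- exact: contr_frame_mem.
Qed.

Let Z_plane (u : 'rV[K]_(1 + 1)) (A : 'M[K]_(1 + l, n)) : isotropic J A ->
  wedge_plane u A \in Z.
Proof.
move=> isoA.
have lin a v w : wedge_plane (a *: v + w) A = a *: wedge_plane v A + wedge_plane w A.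
  rewrite /wedge_plane mulmxDl -scalemxAl.
  exact: (alt_col_linear (@wedge_alternating K _ _)).
have -> : u = lsubmx u 0 0 *: u_e + (rsubmx u 0 0 *: u_f + 0).
  rewrite addr0 -[LHS]hsubmxK !scale_row_mx !scaler0 add_row_mx addr0 add0r.
  by congr row_mx; apply/matrixP => i j; rewrite !ord1 !mxE eqxx mulr1 //.
have z0 : wedge_plane 0 A = 0.
  by have := lin (-1) 0 0; rewrite scaler0 addr0 scaleN1r addNr.
rewrite !lin z0 addr0; apply: memvD; apply: memvZ.
  by apply: Z_e; apply: iso_frame_span.
by apply: Z_f; apply: iso_frame_span.
Qed.

(** Take (p, q) as one of the m + 1 pairs complementing [B]. The vector then differs from
    [contr_frame J mu B] by [mu *+ 2] times the sum of p /\ q /\ B - p_i /\ q_i /\ B over the other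
    m pairs, and these differences lie in the small isotropic span. *)
Let Z_hyperbolic (B : 'M[K]_(l, n)) (p q : 'rV[K]_n) :
    isotropic J B -> p *m J *m q^T = 1%:M ->
    B *m J *m p^T = 0 -> B *m J *m q^T = 0 ->
  wedge_inl (col_mx p (col_mx q B)) - wedge2 (B *m I1) e f \in Z.
Proof.
move=> isoB pq Bp Bq.
have aw : alternating (@wedge K (1 + (1 + l)) N) by apply: wedge_alternating.
have awi := @wedge_inl_alt (1 + (1 + l)).
have [Bfree|nB] := boolP (row_free B); last first.
  have aD : alternating (fun C : 'M[K]_(l, n) =>
      wedge_inl (col_mx p (col_mx q C)) - wedge2 (C *m I1) e f).
    apply: altD; first exact: (alt_dsub (alt_dsub awi p)).
    apply: altN; apply: (@alt_mulmxr _ _ _ _ _ (fun B => wedge2 B e f)).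
    exact: (alt_dsub (alt_dsub aw e)).
  by rewrite -(ext_lift_wedge _ aD) wedge_eq0 // linear0 mem0v.
have [s [P [Q [nE' [PB QB Pp Qp [Pq Qq]] [PP QQ PQ] cE]]]] :=
  adapted_pairs_cons altJ Ju Bfree isoB pq Bp Bq.
have [sm] : s.+1 = m.+1.
  by apply/(@addnI l)/double_inj; rewrite -!addnn -nE' -nE.
subst s.
set W := wedge_inl _; set w := wedge2 _ _ _.
pose Wi i := wedge_inl (col_mx (row i P) (col_mx (row i Q) B)).
have -> : W - w = contr_frame J mu B + \sum_i (mu *+ 2) *: (W - Wi i).
  rewrite contr_frameE cE // -/w -/W -scaler_sumr sumrB sumr_const card_ord.
  rewrite addrAC; congr (_ - _).
  have -> : - mu *: (- (W + \sum_i Wi i) *+ 2) = (mu *+ 2) *: (W + \sum_i Wi i).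
    by rewrite mulNrn scalerN scaleNr opprK -scalerMnr scalerMnl.
  rewrite -scalerDr addrACA addrN addr0.
  by rewrite -mulrS -[W *+ _]scaler_nat scalerA muE scale1r.
apply: memvD; first by apply: Z_c; apply: iso_frame_span => //; apply: contr_frame_alternating.
apply: memv_suml => i _; apply: memvZ; apply: Z_b.
rewrite /W /Wi -!(ext_lift_wedge _ awi) -linearB.
apply: ext_lift_span => //.
apply: (hyperbolic_swap altJ isoB); rewrite ?row_gram ?row_gramr ?PB ?QB ?PQ ?row0 //.
- by rewrite mxE eqxx.
- by apply: (orth_sym0 altJ); rewrite row_gramr Pp row0.
- by apply: (orth_sym0 altJ); rewrite row_gramr Qp row0.
- by apply: (orth_sym0 altJ); rewrite row_gramr Pq row0.
- by apply: (orth_sym0 altJ); rewrite row_gramr Qq row0.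
- exact: orth_sym0.
- exact: orth_sym0.
Qed.

Let row_inlr (x : 'rV[K]_n) (t : 'rV[K]_(1 + 1)) : row_mx x t = x *m I1 + t *m I2.
Proof. by rewrite mul_inl mul_inr add_row_mx addr0 add0r. Qed.

(** Expand (x1 + t1) /\ (x2 + t2) /\ B. The mixed terms belong to the e and f parts; t1 /\ t2 is tau
    e /\ f, and isotropy forces <x1, x2> = - tau, which ties the two remaining terms together. *)
Let Z_block (x1 x2 : 'rV[K]_n) (t1 t2 : 'rV[K]_(1 + 1)) (B : 'M[K]_(l, n)) :
  isotropic J' (col_mx (row_mx x1 t1) (col_mx (row_mx x2 t2) (row_mx B 0)) :
    'M[K]_(1 + (1 + l), N)) ->
  wedge (col_mx (row_mx x1 t1) (col_mx (row_mx x2 t2) (row_mx B 0))) \in Z.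
Proof.
have aw : alternating (@wedge K (1 + (1 + l)) N) by apply: wedge_alternating.
move=> /(isotropic_col_mx _ _ altJ')[_ o1 /(isotropic_col_mx _ _ altJ')[_ o2 isoB']].
have isoB : isotropic J B.
  by move: isoB'; rewrite /isotropic add_plane_row trmx0 mulmx0 addr0.
have x2B : x2 *m J *m B^T = 0.
  by move: o2; rewrite add_plane_row trmx0 mulmx0 addr0.
rewrite tr_col_mx mul_mx_row -[RHS]row_mx0 in o1.
move/eq_row_mx: o1 => [x12 x1B']; have x1B : x1 *m J *m B^T = 0.
  by move: x1B'; rewrite add_plane_row trmx0 mulmx0 addr0.
rewrite -(mul_inl B) !row_inlr.
have [bl br] := alt_bilinear (B *m I1) aw.
pose w u v := wedge2 (B *m I1) u v.
have wDl u v z : w (u + v) z = w u z + w v z.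
  by rewrite /w /wedge2 -[u]scale1r bl !scale1r.
have wDr u v z : w z (u + v) = w z u + w z v.
  by rewrite /w /wedge2 -[u]scale1r br !scale1r.
have wskew u v : w v u = - w u v.
  by apply: (bilinear_skew _ _ (conj bl br)) => z; apply: alt_diag.
have wZl r u v : w (r *: u) v = r *: w u v by apply: (bilinear_Zl _ _ _ (conj bl br)).
have wZr r u v : w u (r *: v) = r *: w u v.
    by rewrite wskew wZl -scalerN -wskew.
have wplane u z : z *m J *m B^T = 0 -> w (u *m I2) (z *m I1) \in Z.
  move=> zB; rewrite /w /wedge2 -mul_col_mx; apply: Z_plane.
  by apply/(isotropic_col_mx _ _ altJ); split=> //; apply: altJ.
rewrite -[wedge _]/(w _ _) wDl !wDr.
rewrite [w (t1 *m I2) _ + _]addrC addrACA.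
rewrite [w (x1 *m I1) (t2 *m I2)]wskew.
apply: memvD; last first.
  by apply: memvD; [rewrite memvN; exact: wplane|exact: wplane].
pose a := lsubmx t1 0 0; pose b := rsubmx t1 0 0.
pose c := lsubmx t2 0 0; pose d := rsubmx t2 0 0.
have tE (t : 'rV[K]_(1 + 1)) : t *m I2 = lsubmx t 0 0 *: e + rsubmx t 0 0 *: f.
  rewrite mul_inr !scale_row_mx !scaler0 !add_row_mx !addr0 add0r -[t in LHS]hsubmxK.
  by congr (row_mx _ (row_mx _ _)); apply/matrixP => i j;
    rewrite !ord1 !mxE eqxx mulr1.
have wtt : w (t1 *m I2) (t2 *m I2) = (a * d - b * c) *: w e f.
  rewrite !tE -/a -/b -/c -/d.
  have waa u : w u u = 0 by apply: alt_diag.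
  rewrite wDl !wDr !wZl !wZr !waa !scaler0 add0r addr0 (wskew e f).
  by rewrite scalerBl !scalerA !scalerN.
have x12' : x1 *m J *m x2^T = - (a * d - b * c)%:M.
  move/eqP: x12; rewrite add_plane_row addr_eq0 => /eqP ->; congr (- _).
  rewrite -(hsubmxK t1) -(hsubmxK t2) sympl_form1_row.
  apply/matrixP => i j; rewrite !ord1 !mxE !big_ord1 !mxE eqxx mulr1n.
  by rewrite /a /b /c /d !mxE.
rewrite wtt; set tau := _ - _ in x12' *.
have [tau0|tau0] := eqVneq tau 0.
  rewrite tau0 scale0r addr0 /w wedge2_inl; apply: Z_b; apply: iso_frame_span => //.
  apply/(isotropic_col_mx _ _ altJ); split; first exact: altJ.
    by rewrite tr_col_mx mul_mx_row x12' tau0 x1B raddf0 oppr0 row_mx0.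
  by apply/(isotropic_col_mx _ _ altJ); split=> //; apply: altJ.
(* The scaling makes (x1, q) a hyperbolic pair. *)
pose q := - tau^-1 *: x2.
have -> : w (x1 *m I1) (x2 *m I1) + tau *: w e f =
    - tau *: (wedge_inl (col_mx x1 (col_mx q B)) - wedge2 (B *m I1) e f).
  rewrite -wedge2_inl -/(w _ _) -/(w e f) /q -scalemxAl wZr.
  by rewrite scalerBr scalerA mulrNN divff // scale1r scaleNr opprK.
apply: memvZ; apply: Z_hyperbolic => //.
- rewrite /q linearZ /= -scalemxAr x12' scalerN scaleNr opprK.
  by rewrite scale_scalar_mx mulVf.
- exact: orth_sym0.
- by rewrite /q linearZ /= -scalemxAr (orth_sym0 altJ x2B) scaler0.
Qed.

(** Invertible row operations only rescale the wedge, and the plane components of the rows have rank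
    at most 2; so all rows but two can be moved into the small space. *)
Let Z_sup : (iso_span J' (1 + (1 + l)) <= Z)%VS.
Proof.
apply: iso_span_sub => D isoD.
pose L : 'M[K]_(1 + (1 + l)) := col_ebase (rsubmx D).
have Lu : L \in unitmx := col_ebase_unit (rsubmx D).
pose G := invmx L *m D.
rewrite -(mulKVmx Lu D) -/G wedge_mull; apply: memvZ.
have isoG : isotropic J' G.
  rewrite /isotropic /G trmx_mul -!mulmxA (mulmxA D) (mulmxA (D *m _)).
  by rewrite isoD mul0mx mulmx0.
have rG : rsubmx G = pid_mx (\rank (rsubmx D)) *m row_ebase (rsubmx D).
  by rewrite /G -mulmx_rsub -[X in _ *m X = _]mulmx_ebase -mulmxA mulKmx.
clearbody G.
(* [pid_mx] is diagonal with two columns, so its rows beyond the second are zero. *)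
have Gz i j : G (rshift 1 (rshift 1 i)) (rshift n j) = 0.
  move/matrixP: rG => /(_ (rshift 1 (rshift 1 i)) j); rewrite mxE => ->.
  rewrite mxE big1 // => r _; rewrite mxE; case: eqP => /= [rE|_]; last by rewrite mul0r.
  by have := ltn_ord r; rewrite -rE.
have GE : G = col_mx (row_mx (lsubmx (usubmx G)) (rsubmx (usubmx G)))
   (col_mx (row_mx (lsubmx (usubmx (dsubmx G))) (rsubmx (usubmx (dsubmx G))))
     (row_mx (lsubmx (dsubmx (dsubmx G))) 0)).
  rewrite (_ : 0 = rsubmx (dsubmx (dsubmx G))); first by rewrite !hsubmxK !vsubmxK.
  by apply/matrixP => i j; rewrite !mxE Gz.
rewrite GE; apply: Z_block; rewrite -GE; exact: isoG.
Qed.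

(** The e part and the f part are each isotropic and are paired with each other by plus or minus the
    form of the small space, hence the factor 2. The last block is the form in degree [l] scaled by
    [mu *+ 2 + 1], so it counts fully or not at all. *)
Theorem iso_rank_add_plane : iso_rank J' l.+2 =
  (2 * iso_rank J l.+1 + iso_rank J l.+2 +
   (if (mu *+ 2 + 1 == 0)%R then 0 else iso_rank J l))%N.
Proof.
have eZ : Z = iso_span J' (1 + (1 + l)) by apply/eqP; rewrite eqEsubv Z_sub Z_sup.
rewrite -[iso_rank J' _](iso_rank_fam eZ) /fam.
have isoB k i := @iso_framesP K n J k i.
have fc_in i : fc i \in iso_span J' (1 + (1 + l)) by apply: contr_frame_mem.
have cp u i (A : 'M[K]_(1 + l, n)) : isotropic J A -> u = u_e \/ u = u_f ->
    pairing J' (fc i) (wedge_plane u A) = 0.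
  move=> isoA ue; rewrite pairing_contr_frame //; last exact: isotropic_plane.
  case: ue => ->; rewrite /wedge_plane.
    rewrite wedge2_plane0 ?mulr0 // tr_col_mx mul_mx_row plane_inl mul_inr.
    by rewrite -[row_mx 0 u_e]/e plane_ee // row_mx0.
  rewrite wedge2_plane_f ?mulr0 // tr_col_mx mul_mx_row plane_inl mul_inr.
  by rewrite -[row_mx 0 u_f]/f plane_ff // row_mx0.
have cb i j : pairing J' (fc i) (fb j) = 0.
  rewrite pairing_contr_frame //; last exact: isotropic_inl.
  by rewrite wedge2_plane0 ?mulr0 // plane_inl.
have pb u i (A : 'M[K]_(1 + l, n)) : pairing J' (wedge_plane u A) (fb i) = 0.
  exact: pairing_plane0.
have sym x y : pairing J' x y = 0 -> pairing J' y x = 0 :> K.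
  by move=> xy; rewrite (pairing_sym _ _ altJ') xy mulr0.
have pp u v (A B : 'M[K]_(1 + l, n)) :
    pairing J' (wedge_plane u A) (wedge_plane v B) =
    (u *m sympl_form K 1 *m v^T) 0 0 * pairing J (wedge A) (wedge B).
  exact: pairing_plane.
have ab i j : pairing J' (fam_cat fe ff i) (fam_cat fb fc j) = 0.
  rewrite /fam_cat; case: fintype.split => i1; case: fintype.split => j1.
  - exact: pb.
  - by apply/sym/cp => //; left.
  - exact: pb.
  - by apply/sym/cp => //; right.
rewrite (rank_gram_orth ab) => [|i j]; last exact/sym/ab.
rewrite (rank_gram_isotropic (x := fe)); first last.
- by move=> i j; rewrite pp sympl_form_alternate mxE mul0r.
- by move=> i j; rewrite pp sympl_form_alternate mxE mul0r.
rewrite (rank_gram_orth (x := fb)); first last.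
- by move=> i j; apply: cb.
- by move=> i j; apply/sym/cb.
have gE k (A : 'M[K]_k) : \rank (- A) = \rank A by rewrite mxrank_opp.
have g_ef : gram (pairing J' (k := 1 + (1 + l))) fe ff =
    gram (pairing J (k := l.+1)) (fun i => wedge (iso_frames i)) (fun i => wedge (iso_frames i)).
  apply/matrixP => i j; rewrite !mxE pp sympl_form1_row !trmx1 trmx0 mulmx0 subr0.
  by rewrite mulmx1 mxE eqxx mul1r.
have g_fe : gram (pairing J' (k := 1 + (1 + l))) ff fe =
    - gram (pairing J (k := l.+1)) (fun i => wedge (iso_frames i)) (fun i => wedge (iso_frames i)).
  apply/matrixP => i j; rewrite !mxE pp sympl_form1_row !trmx1 trmx0 mulmx0 sub0r.
  by rewrite mulmx1 !mxE eqxx mulN1r.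
have g_b : gram (pairing J' (k := 1 + (1 + l))) fb fb =
    gram (pairing J (k := l.+2)) (fun i => wedge (iso_frames i)) (fun i => wedge (iso_frames i)).
  by apply/matrixP => i j; rewrite !mxE !pairing_wedge inl_inl.
have g_c : gram (pairing J' (k := 1 + (1 + l))) fc fc =
    (mu *+ 2 + 1) *: gram (pairing J (k := l)) (fun i => wedge (iso_frames i)) (fun i => wedge (iso_frames i)).
  by apply/matrixP => i j; rewrite !mxE pairing_contr_contr // fc_in.
rewrite g_ef g_fe g_b g_c gE -!/(iso_rank _ _) addnn -mul2n addnA.
congr (_ + _)%N; case: eqP => [->|/eqP nz]; first by rewrite scale0r mxrank0.
by rewrite mxrank_scale_nz.
Qed.

End Recursion.

(** * The rank formula *)

Section RankFormula.

Variable K : fieldType.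

Lemma darboux_inv n (J : 'M[K]_n) t (X Y : 'M[K]_(t, n)) :
    alternate_mx J -> n = (t + t)%N -> darboux J X Y ->
  exists R, R *m col_mx X Y = 1%:M /\ col_mx X Y *m R = 1%:M.
Proof.
move=> altJ nE dXY; have g := darboux_gram altJ dXY.
exists (J *m (col_mx X Y)^T *m - sympl_form K t).
have AR : col_mx X Y *m (J *m (col_mx X Y)^T *m - sympl_form K t) = 1%:M.
  by rewrite !mulmxA g mulmxN sympl_form_sq opprK.
by split=> //; apply: (mulmx1C_eq nE AR).
Qed.

Lemma iso_rank_darboux n (J : 'M[K]_n) t (X Y : 'M[K]_(t, n)) k :
    alternate_mx J -> n = (t + t)%N -> darboux J X Y ->
  iso_rank (sympl_form K t) k = iso_rank J k.
Proof.
move=> altJ nE dXY; have g := darboux_gram altJ dXY.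
have [R [RA AR]] := darboux_inv altJ nE dXY.
apply/eqP; rewrite eqn_leq (iso_rank_congr_le _ g) /=.
apply: (iso_rank_congr_le (A := R)).
rewrite -g !mulmxA RA mul1mx -!mulmxA -trmx_mul RA trmx1 mulmx1.
by [].
Qed.

(** The two matrices order the basis differently. A symplectic basis grown from the empty frame
    gives the congruence. *)
Lemma iso_rank_symplS g k :
  iso_rank (sympl_form K g.+1) k = iso_rank (add_plane (sympl_form K g)) k.
Proof.
have altJ := add_plane_alternate (@sympl_form_alternate K g).
have Ju := add_plane_unit (sympl_form_unit K g).
have fr : row_free (0 : 'M[K]_(0, g + g + (1 + 1))) by rewrite /row_free mxrank0.
have iso : isotropic (add_plane (sympl_form K g)) (0 : 'M[K]_(0, g + g + (1 + 1))).
  by rewrite /isotropic !mul0mx.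
have [s [P [Y [nE dPY]]]] := darboux_extend altJ Ju fr iso.
have sE : s = g.+1.
  move: nE; rewrite !add0n -[LHS]/((g + g + 2)%N) addn2 !addnn -doubleS.
  by move/double_inj.
rewrite -sE; exact: (iso_rank_darboux _ altJ nE dPY).
Qed.

(* The entry (C^g)_(m + 1, 1): C is 2 plus the adjacency matrix of the path with
   vertices 0, 1, 2, 3. *)
Fixpoint walks (g m : nat) : nat :=
  if g is g'.+1 then
    (2 * walks g' m + (if m is m'.+1 then walks g' m' else 0) +
     (if (m < 3)%N then walks g' m.+1 else 0))%N
  else (m == 0)%N.

(** Induction on the genus; the three terms of the recursion have g - k equal to m, m - 1 and m + 1.
    Lengths 0 and 1 lie outside the recursion and are computed directly. Both ends of the path have
    a meaning: at m = 0 frames longer than half the dimension would be required, at m = 3 the factor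
    5/4 is zero. *)
Lemma iso_rank_sympl g k m : 5%N \in [pchar K] -> (m <= 3)%N -> (k + m)%N = g ->
  iso_rank (sympl_form K g) k = walks g m.
Proof.
move=> ch5; elim: g k m => [|g IH] k m m3 kmg.
  have [-> ->] : k = 0%N /\ m = 0%N by move/eqP: kmg; rewrite addn_eq0 => /andP[/eqP -> /eqP ->].
  exact: iso_rank0.
case: k kmg => [|[|l]] kmg.
- rewrite iso_rank0; rewrite add0n in kmg; subst m.
  by case: g m3 {IH} => [|[|[|]]].
- rewrite iso_rank1; last exact: sympl_form_alternate.
  rewrite mxrank_unit ?sympl_form_unit //; case: kmg => kmg.
  rewrite add0n in kmg; subst m.
  by case: g m3 {IH} => [|[|[|[|]]]].
have nz (i : nat) : (0 < i < 5)%N -> i%:R != 0 :> K.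
  case/andP => i0 i5; rewrite -(dvdn_pcharf ch5) gtnNdvd //.
case: kmg => kmg; rewrite iso_rank_symplS.
pose mu : K := (2%:R * m.+1%:R)^-1.
have m1 : m.+1%:R != 0 :> K by apply: nz.
have two : 2%:R != 0 :> K by apply: nz.
have muE : mu *+ 2 * m.+1%:R = 1.
  by rewrite -[mu *+ 2]mulr_natr -mulrA mulVf // mulf_neq0.
rewrite (@iso_rank_add_plane _ _ _ (@sympl_form_alternate K g) (sympl_form_unit K g) l m mu) //; last first.
  by rewrite -kmg addSnnS.
have lam0 : (mu *+ 2 + 1 == 0)%R = (m == 3)%N.
  have -> : mu *+ 2 + 1 = m.+2%:R / m.+1%:R.
    have -> : mu *+ 2 = m.+1%:R^-1 by apply: (mulIf m1); rewrite muE mulVf.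
    by rewrite -[m.+2%:R]natr1 mulrDl divff // mul1r addrC.
  rewrite mulf_eq0 invr_eq0 (negbTE m1) orbF -(dvdn_pcharf ch5).
  by case: m m3 {kmg muE m1 mu} => [|[|[|[|]]]].
rewrite lam0 (IH l.+1 m m3 kmg) /=.
congr (_ + _ + _)%N.
  case: m m3 kmg {muE m1 mu lam0} => [|m] m3 kmg; last first.
    by apply: IH; [apply: ltnW|rewrite -kmg addnS].
  apply: iso_rank_eq0; first exact: sympl_form_unit.
  by rewrite -kmg addn0 !addnS !addSn.
case: eqP => [->|m_neq3] //.
have m_lt3 : (m < 3)%N by rewrite ltn_neqAle m3 andbT; apply/eqP.
by rewrite m_lt3; apply: IH; rewrite // addnS -kmg.
Qed.

End RankFormula.

(** * Gow's modules *)

Section GowModules.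

Variable K : fieldType.

Lemma limg_mulmxr a b (M : 'M[K]_(a, b)) :
  limg (linfun (mulmxr M : 'rV_a -> 'rV_b)) = fam_span (fun i => row i M).
Proof.
apply/eqP; rewrite eqEsubv; apply/andP; split.
  apply/subvP => _ /memv_imgP[u _ ->]; rewrite lfunE /= mulmx_sum_row.
  by apply: memv_suml => i _; apply/memvZ/(mem_fam (fun i => row i M)).
apply: fam_span_sub => i; rewrite rowE.
by apply/memv_imgP; exists (delta_mx 0 i); rewrite ?memvf // lfunE.
Qed.

Lemma dim_row_span a b (M : 'M[K]_(a, b)) :
  \dim (fam_span (fun i => row i M)) = \rank M.
Proof.
have freeE r (N : 'M[K]_(r, b)) : row_free N -> \dim (fam_span (fun i => row i N)) = r.
  move=> Nfree; rewrite -limg_mulmxr limg_dim_eq ?dimvf /=; first by rewrite /dim /= mul1n.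
  apply/eqP; rewrite -subv0; apply/subvP => u; rewrite memv_cap => /andP[_].
  by rewrite memv_ker lfunE /= memv0 mulmx_free_eq0.
rewrite -[RHS](freeE _ _ (row_base_free M)); congr (\dim _).
apply/eqP; rewrite eqEsubv; apply/andP; split; apply: fam_span_sub => i.
  have /submxP[D ->] : (row i M <= row_base M)%MS by rewrite eq_row_base row_sub.
  rewrite mulmx_sum_row; apply: memv_suml => j _.
  by apply/memvZ/(mem_fam (fun i => row i (row_base M))).
have /submxP[D ->] : (row i (row_base M) <= M)%MS.
  by rewrite (submx_trans (row_sub i _)) // eq_row_base.
rewrite mulmx_sum_row; apply: memv_suml => j _.
by apply/memvZ/(mem_fam (fun i => row i M)).
Qed.

(** * The symplectic action on isotropic wedges *)

Section Action.
Variables g k : nat.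
Local Notation J := (sympl_form K g).
Implicit Types (A : 'M[K]_(g + g)) (x y : ext K k (g + g)).
Local Notation is_symplectic := (@Defs.is_symplectic K g).

Lemma ext_actE A x : ext_act A x = ext_lift (fun B => wedge (B *m A)) x.
Proof. by apply: eq_bigr => f _; rewrite rowsubE. Qed.

Lemma ext_act_wedge A (B : 'M[K]_(k, g + g)) : ext_act A (wedge B) = wedge (B *m A).
Proof. by rewrite ext_actE ext_lift_wedge //; exact/alt_mulmxr/wedge_alternating. Qed.

Lemma ext_act_comp A A' x : ext_act A' (ext_act A x) = ext_act (A *m A') x.
Proof.
rewrite (ext_actE A') [ext_act A x]/ext_act linear_sum [RHS]/ext_act.
apply: eq_bigr => f _; rewrite linearZ /= -ext_actE ext_act_wedge.
by rewrite (rowsubE _ A) (rowsubE _ (A *m A')) mulmxA.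
Qed.

Lemma ext_act1 x : ext_act 1%:M x = x.
Proof. by rewrite {2}(ext_basis x). Qed.

Lemma pairing_ext_act A x y : is_symplectic A ->
  pairing J (ext_act A x) (ext_act A y) = pairing J x y.
Proof.
move=> sA.
rewrite {2}(ext_basis x) {2}(ext_basis y) {1 2}/ext_act.
rewrite !(form_suml (@pairing_linl _ _ _ _)); apply: eq_bigr => f _; congr (_ * _).
rewrite !(form_sumr (@pairing_linr _ _ _ _)); apply: eq_bigr => h _; congr (_ * _).
rewrite (rowsubE (val f) A) (rowsubE (val h) A) !pairing_wedge.
by rewrite trmx_mul !mulmxA -(mulmxA _ A) -(mulmxA _ (A *m _)) sA.
Qed.

Lemma symplectic_unit A : is_symplectic A -> A \in unitmx.
Proof.
move=> sA; have := sympl_form_unit K g; rewrite -sA -mulmxA.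
by rewrite unitmx_mul => /andP[].
Qed.

Lemma symplectic_inv A : is_symplectic A -> is_symplectic (invmx A).
Proof.
move=> sA; have Au := symplectic_unit sA; rewrite /is_symplectic -{1}sA.
by rewrite !mulmxA mulVmx // mul1mx -!mulmxA trmx_inv mulmxV ?unitmx_tr // mulmx1.
Qed.

Lemma symplectic_mul A A' : is_symplectic A -> is_symplectic A' -> is_symplectic (A *m A').
Proof.
by move=> sA sA'; rewrite /is_symplectic trmx_mul !mulmxA -(mulmxA A) -(mulmxA A) sA' sA.
Qed.

Lemma symplectic_form : is_symplectic J.
Proof.
rewrite /is_symplectic (alternate_tr (@sympl_form_alternate K g)) mulmxN.
by rewrite sympl_form_sq mulNmx mul1mx opprK.
Qed.

Lemma iso_span_ext_act A x : is_symplectic A ->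
  x \in iso_span J k -> ext_act A x \in iso_span J k.
Proof.
move=> sA /fam_spanP[c ->]; rewrite ext_actE linear_sum; apply: memv_suml => i _.
rewrite linearZ /= -ext_actE ext_act_wedge; apply/memvZ/mem_iso_span.
rewrite /isotropic trmx_mul !mulmxA -(mulmxA _ A) -(mulmxA _ (A *m _)) sA.
exact: iso_framesP.
Qed.

(** A symplectic basis extending the frame, read as the rows of a matrix, is itself a symplectic
    matrix. *)
Lemma symplectic_extend (B : 'M[K]_(k, g + g)) : row_free B -> isotropic J B ->
  exists2 A, is_symplectic A &
    forall (i : 'I_k) (j : 'I_(g + g)), i = j :> nat -> row j A = row i B.
Proof.
move=> Bfree isoB.
have [s [P [Y [nE dPY]]]] :=
  darboux_extend (@sympl_form_alternate K g) (sympl_form_unit K g) Bfree isoB.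
have gE : g = (k + s)%N by apply/double_inj; rewrite -!addnn.
clear nE; subst g; exists (col_mx (col_mx B P) Y).
  exact: darboux_gram (@sympl_form_alternate K (k + s)) dPY.
move=> i j ij; have -> : j = lshift (k + s) (lshift s i) by apply/val_inj.
by rewrite !rowKu.
Qed.

Hypothesis kg : (k <= g)%N.

Let H : 'M[K]_(k, g + g) := \matrix_(i, j) (i == j :> nat)%:R.

Let kgg : (k <= g + g)%N := leq_trans kg (leq_addr g g).

Let h0_incr : increasing [ffun i : 'I_k => widen_ord kgg i].
Proof. by apply/forallP => i; apply/forallP => j; apply/implyP; rewrite !ffunE. Qed.

Definition high_index : multiindex k (g + g) := Sub _ h0_incr.

Let h0E i : val high_index i = widen_ord kgg i.
Proof. by rewrite ffunE. Qed.

Let HE : H = rowsub (val high_index) 1%:M.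
Proof. by apply/matrixP => i j; rewrite !mxE h0E. Qed.

Lemma high_vectorE : high_vector K g k = basis_ext K high_index.
Proof. by rewrite /basis_ext -HE. Qed.

Lemma wedge_high_orbit (B : 'M[K]_(k, g + g)) : row_free B -> isotropic J B ->
  exists2 A, is_symplectic A & wedge B = ext_act A (high_vector K g k).
Proof.
move=> Bfree isoB.
have [A sA AB] := symplectic_extend Bfree isoB.
exists A => //; rewrite ext_act_wedge -/H HE -rowsubE; congr wedge.
apply/row_matrixP => i; rewrite row_rowsub -(AB i (val high_index i)) //.
by rewrite h0E.
Qed.

(** [J] sends e_i to its partner f_i, so these rows are f_1, ..., f_k. Their wedge has the opposite
    of the highest weight, and pairing with it extracts the coefficient of e_1 /\ ... /\ e_k. *)
Definition low_frame : 'M[K]_(k, g + g) := H *m J.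

Lemma low_frame_isotropic : isotropic J low_frame.
Proof.
rewrite /isotropic /low_frame trmx_mul !mulmxA -(mulmxA H J J) -(mulmxA H (J *m J)).
rewrite symplectic_form HE -rowsubE trmx_mxsub trmx1 mulmx_colsub mulmx1.
have hE i : val high_index i = lshift g (widen_ord kg i) by rewrite h0E; apply/val_inj.
by apply/matrixP => i j; rewrite 2![LHS]mxE !hE block_mxEul !mxE.
Qed.

Lemma pairing_low x : pairing J x (wedge low_frame) = x high_index.
Proof.
rewrite {1}(ext_basis x) (form_suml (@pairing_linl _ _ _ _)) (bigD1 high_index) //=.
have pb f : pairing J (basis_ext K f) (wedge low_frame) = basis_ext K f high_index.
  rewrite pairing_wedge /low_frame trmx_mul -!mulmxA (mulmxA J J^T).
  rewrite (alternate_tr (@sympl_form_alternate K g)) mulmxN sympl_form_sq opprK mul1mx.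
  rewrite [RHS]ffunE; congr (\det _); rewrite HE trmx_mxsub trmx1.
  by rewrite mulmx_colsub mulmx1.
rewrite big1 ?addr0 => [|f fh]; rewrite pb basis_extE ?eqxx ?mulr1 //.
by rewrite (negbTE fh) mulr0.
Qed.

(** * Torus weights and the dimension of Gow's modules *)

Section Torus.
Variable a : K.
Hypotheses (a0 : a != 0) (a1 : a != 1) (aV : a != a^-1).

Let torus_row (i : 'I_g) : 'rV[K]_g := \row_j (if j == i then a else 1).
Let torus_diag i : 'rV[K]_(g + g) :=
  row_mx (torus_row i) (map_mx GRing.inv (torus_row i)).
Let torus i : 'M[K]_(g + g) := diag_mx (torus_diag i).

Let torus_symplectic i : is_symplectic (torus i).
Proof.
have tE : torus i = block_mx (diag_mx (torus_row i)) 0 0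
    (diag_mx (map_mx GRing.inv (torus_row i))) by rewrite /torus diag_mx_row.
have dd : diag_mx (torus_row i) *m diag_mx (map_mx GRing.inv (torus_row i)) = 1%:M.
  rewrite mulmx_diag -diag_const_mx; congr diag_mx; apply/rowP => j; rewrite !mxE.
  by case: eqP => _; rewrite divff // oner_eq0.
rewrite /is_symplectic tE /sympl_form tr_block_mx !tr_diag_mx !trmx0.
rewrite !mulmx_block !(mulmx0, mul0mx, mulmx1, mul1mx, addr0, add0r).
by rewrite dd mulmxN mulmx1 mulNmx diag_mxC dd.
Qed.

Let weight (i : 'I_g) (f : multiindex k (g + g)) : K :=
  \prod_j torus_diag i 0 (val f j).

Let basis_scaleE c h f : (c *: basis_ext K h : ext K k (g + g)) f = c * (h == f)%:R.
Proof. by rewrite ffunE basis_extE. Qed.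

Let torus_act i x f : ext_act (torus i) x f = weight i f * x f.
Proof.
have tb h : ext_act (torus i) (basis_ext K h) = weight i h *: basis_ext K h.
  rewrite ext_act_wedge /weight.
  have -> : rowsub (val h) 1%:M *m torus i =
      diag_mx (\row_j torus_diag i 0 (val h j)) *m rowsub (val h) 1%:M.
    apply/matrixP => r c; rewrite mul_mx_diag mul_diag_mx !mxE.
    by case: eqP => [->|_]; rewrite ?mulr0 ?mul0r // mulr1 mul1r.
  rewrite wedge_mull det_diag; congr (_ *: _); apply: eq_bigr => j _.
  by rewrite mxE.
rewrite (ext_actE _ x) {1}(ext_basis x) linear_sum sum_ffunE (bigD1 f) //= big1 => [|h hf].
  by rewrite linearZ /= -ext_actE tb scalerA basis_scaleE eqxx addr0 mulr1 mulrC.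
by rewrite linearZ /= -ext_actE tb scalerA basis_scaleE (negbTE hf) mulr0.
Qed.

Let torus_diagE i c : torus_diag i 0 c =
  if c == lshift g i then a else if c == rshift g i then a^-1 else 1.
Proof.
case: (split_ordP c) => j ->.
  by rewrite row_mxEl mxE (inj_eq (@lshift_inj _ _)) eq_lrshift.
rewrite row_mxEr !mxE (inj_eq (@rshift_inj _ _)) eq_rlshift.
by case: eqP; rewrite ?invr1.
Qed.

Let weight_high (i : 'I_k) : weight (widen_ord kg i) high_index = a.
Proof.
have hE j : val high_index j = lshift g (widen_ord kg j) by rewrite h0E; apply/val_inj.
rewrite /weight (bigD1 i) //= big1 => [|j ji].
  by rewrite torus_diagE hE eqxx mulr1.
rewrite torus_diagE hE (inj_eq (@lshift_inj _ _)) eq_lrshift.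
by case: eqP => // /(congr1 val) /= /val_inj jiE; rewrite jiE eqxx in ji.
Qed.

Let weight_not_high (i : 'I_g) (f : multiindex k (g + g)) : lshift g i \notin codom (val f) ->
  weight i f = 1 \/ weight i f = a^-1.
Proof.
move=> fi; have ne j : (val f j == lshift g i) = false.
  by apply: contraNF fi => /eqP <-; apply: codom_f.
have [/codomP[r rE]|nr] := boolP (rshift g i \in codom (val f)).
  right; rewrite /weight (bigD1 r) //= big1 => [|j jr].
    by rewrite torus_diagE ne -rE eqxx mulr1.
  rewrite torus_diagE ne rE; case: eqP => // /(@multiindex_inj _ _ f) jrE.
  by rewrite jrE eqxx in jr.
left; rewrite /weight big1 // => j _; rewrite torus_diagE ne.
by case: eqP => // jE; rewrite -jE codom_f in nr.
Qed.

(** Let t_i scale e_i by [a] and f_i by its inverse. The operator (t_i - 1)(t_i - a^-1) kills the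
    basis vectors that omit e_i and is nonzero on the highest one. Applied for all i <= k, these
    operators turn a vector of [U] into a multiple of the highest vector, nonzero when the
    coefficient in question is. *)
Lemma stable_coef_high (U : {vspace ext K k (g + g)}) x : sp_stable U ->
  x \in U -> high_vector K g k \notin U -> x high_index = 0.
Proof.
move=> Ust xU; apply: contraNeq => xh.
pose q i f := (weight i f - 1) * (weight i f - a^-1).
have step (s : seq 'I_k) : exists2 y, y \in U &
    forall f, y f = x f * \prod_(i <- s) q (widen_ord kg i) f.
  elim: s => [|i s [y yU yE]]; first by exists x => // f; rewrite big_nil mulr1.
  pose t := torus (widen_ord kg i).
  have tU w : w \in U -> ext_act t w \in U by apply: Ust; apply: torus_symplectic.
  pose z := ext_act t y - y.
  have zU : z \in U by apply: memvB => //; apply: tU.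
  exists (ext_act t z - a^-1 *: z).
    by apply: memvB; [apply: tU|apply: memvZ].
  move=> f; rewrite !ffunE !torus_act !ffunE !torus_act yE big_cons /q.
  by rewrite -[_ *: _]/(_ * _); ring.
have [y yU yE] := step (enum 'I_k).
have y0 f : f != high_index -> y f = 0.
  move=> fh; rewrite yE.
  have [i fi] : exists i : 'I_k, val high_index i \notin codom (val f).
    apply/existsP; rewrite -negb_forall; apply: contraNN fh => /forallP all_in.
    by apply/eqP/esym/multiindex_eq.
  have hi : lshift g (widen_ord kg i) \notin codom (val f).
    by rewrite (_ : lshift _ _ = val high_index i) // h0E; apply/val_inj.
  rewrite (bigD1_seq i) ?mem_enum ?enum_uniq //= /q.
  by have [->|->] := weight_not_high hi; rewrite subrr ?mulr0 ?mul0r ?mulr0.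
have yh : y high_index != 0.
  rewrite yE mulf_neq0 // prodf_seq_neq0; apply/allP => i _ /=.
  by rewrite /q weight_high mulf_neq0 // subr_eq0.
have -> : high_vector K g k = (y high_index)^-1 *: y.
  rewrite high_vectorE; apply/ffunP => f; rewrite [RHS]ffunE basis_extE.
  have [<-|fh] := eqVneq high_index f; first exact/esym/mulVf.
  by rewrite (y0 f) 1?eq_sym //; apply/esym/mulr0.
exact: memvZ.
Qed.

(** With R the orthogonal of W, one has W + bot = top and W meets bot exactly in W meet R. Hence top
    / bot is W modulo its radical, whatever subquotient presents the module. *)
Theorem gow_dim_iso_rank (V : gow_module K g k) : gow_dim V = iso_rank J k.
Proof.
case: V => top bot topS botS bt vt vb irr; rewrite /gow_dim /=.
set v := high_vector K g k in vt vb.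
pose W := iso_span J k.
have WS : sp_stable W by move=> A sA x; apply: iso_span_ext_act.
have addS (U U' : {vspace ext K k (g + g)}) :
    sp_stable U -> sp_stable U' -> sp_stable (U + U')%VS.
  move=> US U'S A sA x /memv_addP[y yU [z zU ->]].
  rewrite ext_actE linearD /= -!ext_actE; apply: memv_add; [exact: US|exact: U'S].
have Wt : (W <= top)%VS.
  apply: iso_span_sub => B isoB; have [Bfree|nB] := boolP (row_free B).
    by have [A sA ->] := wedge_high_orbit Bfree isoB; apply: topS.
  by rewrite wedge_eq0 ?mem0v.
have vW : v \in W.
  have -> : v = ext_act (invmx J) (wedge low_frame).
    by rewrite ext_act_wedge mulmxK ?sympl_form_unit.
  apply: WS; first exact/symplectic_inv/symplectic_form.
  exact/mem_iso_span/low_frame_isotropic.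
have Wbt : (W + bot)%VS = top.
  have := irr (W + bot)%VS (addS _ _ WS botS) (addvSr _ _).
  rewrite subv_add Wt bt => /(_ isT)[] // e.
  by case/negP: vb; rewrite -e (subvP (addvSl _ _)).
(* The kernel of [T] is the orthogonal of [W], and its values on the spanning wedges are the rows of
   the Gram matrix. *)
pose T (x : ext K k (g + g)) : 'rV[K]_(iso_frames_size J k) :=
  \row_i pairing J x (wedge (iso_frames i)).
have Tlin : linear T.
  by move=> c x y; apply/rowP => i; rewrite !mxE pairing_linl.
pose Tm : {linear ext K k (g + g) -> 'rV[K]_(iso_frames_size J k)} :=
  HB.pack T (GRing.isLinear.Build K _ _ *:%R T Tlin).
pose R := lker (linfun Tm).
have pD x y z : pairing J (x + y) z = pairing J x z + pairing J y z.
  by rewrite -[x]scale1r pairing_linl mul1r scale1r.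
have RP x : reflect (forall B, isotropic J B -> pairing J x (wedge B) = 0) (x \in R).
  rewrite memv_ker lfunE; apply: (iffP eqP) => [Tx0 B isoB|xB].
    have /fam_spanP[c ->] := mem_iso_span isoB.
    rewrite (form_sumr (@pairing_linr _ _ _ _)) big1 // => i _.
    by move/rowP: Tx0 => /(_ i); rewrite !mxE => ->; rewrite mulr0.
  by apply/rowP => i; rewrite !mxE xB //; apply: iso_framesP.
have RS : sp_stable R.
  move=> A sA x /RP xR; apply/RP => B isoB.
  have Au := symplectic_unit sA.
  rewrite -(pairing_ext_act _ _ (symplectic_inv sA)) ext_act_comp mulmxV //.
  rewrite ext_act1 ext_act_wedge; apply: xR.
  rewrite /isotropic trmx_mul !mulmxA -(mulmxA B) -(mulmxA B).
  by rewrite (symplectic_inv sA).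
(* Otherwise the sum with [bot] is [top], and v = r + b with r in [R] and b in [bot]; pairing with
   the low wedge then gives 1 = 0 + 0. *)
have Rb : (R :&: W <= bot)%VS.
  have RWS : sp_stable (R :&: W)%VS.
    by move=> A sA x; rewrite !memv_cap => /andP[xR xW]; rewrite RS ?WS.
  have := irr (R :&: W + bot)%VS (addS _ _ RWS botS) (addvSr _ _).
  rewrite subv_add bt (subv_trans (capvSr _ _) Wt) => /(_ isT)[<-|e].
    exact: addvSl.
  move: vt; rewrite -e => /memv_addP[r]; rewrite memv_cap => /andP[/RP rR _].
  move=> [b bb vE]; have := pairing_low v.
  have -> : v high_index = 1 by rewrite /v high_vectorE basis_extE eqxx.
  rewrite vE pD (rR _ low_frame_isotropic) pairing_low.
  by rewrite (stable_coef_high botS bb) // addr0 => /esym/eqP; rewrite oner_eq0.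
(* A nonzero isotropic wedge is a translate of the low one. Moving the translation to the other
   argument turns the pairing into the highest coefficient of a vector of [bot], which vanishes. *)
have bR : (W :&: bot <= R)%VS.
  apply/subvP => x; rewrite memv_cap => /andP[xW xb]; apply/RP => B isoB.
  have [Bfree|nB] := boolP (row_free B); last first.
    have := pairing_linr J (-1) 0 0 x.
    by rewrite wedge_eq0 // scaler0 addr0 mulN1r addNr.
  have [A sA ->] := wedge_high_orbit Bfree isoB.
  have -> : high_vector K g k = ext_act (invmx J) (wedge low_frame).
    by rewrite ext_act_wedge mulmxK ?sympl_form_unit.
  have sJA : is_symplectic (invmx J *m A).
    exact/symplectic_mul/sA/symplectic_inv/symplectic_form.
  rewrite ext_act_comp -(pairing_ext_act _ _ (symplectic_inv sJA)).
  rewrite [ext_act _ (ext_act _ (wedge _))]ext_act_comp mulmxV ?symplectic_unit //.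
  rewrite ext_act1 pairing_low; apply: (stable_coef_high botS) => //.
  exact/botS/xb/symplectic_inv.
have -> : (\dim top - \dim bot = \dim (linfun Tm @: W))%N.
  have e : (W :&: lker (linfun Tm) = W :&: bot)%VS.
    rewrite -/R; apply/eqP; rewrite eqEsubv; apply/andP; split.
      by rewrite subv_cap capvSl capvC Rb.
    by rewrite subv_cap capvSl bR.
  have := dimv_sum_cap W bot; rewrite Wbt -(limg_ker_dim (linfun Tm) W) e.
  by rewrite addnC -addnA => /addnI ->; rewrite addnK.
rewrite /iso_rank -dim_row_span; congr (\dim _).
rewrite /W /iso_span /fam_span limg_sum; apply: eq_bigr => i _.
rewrite limg_line lfunE; congr (<[_]>)%VS; apply/rowP => j.
by rewrite !mxE.
Qed.

End Torus.

End Action.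

End GowModules.

(** * The Verlinde side *)

Section VerlindeNumbers.

Variable R : realType.

Local Notation s := (sin (pi / 5) : R).
Local Notation c := (cos (pi / 5) : R).

Lemma sin_pi5_gt0 : 0 < s.
Proof.
apply: sin_gt0_pi; rewrite ?divr_gt0 ?pi_gt0 //=.
have := pi_gt0 R; lra.
Qed.

Lemma sin_2pi5 : sin (2 * pi / 5 : R) = 2 * s * c.
Proof.
have -> : 2 * pi / 5 = pi / 5 + pi / 5 :> R by field.
by rewrite sinD; ring.
Qed.

Lemma cos_2pi5 : cos (2 * pi / 5 : R) = 2 * c ^+ 2 - 1.
Proof.
have -> : 2 * pi / 5 = pi / 5 + pi / 5 :> R by field.
by rewrite cosD -!expr2 sin2cos2; ring.
Qed.

Lemma sin_3pi5 : sin (3 * pi / 5 : R) = 2 * s * c.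
Proof.
have -> : 3 * pi / 5 = pi - 2 * pi / 5 :> R by field.
by rewrite sinB sinpi cospi sin_2pi5; ring.
Qed.

(** Compare sin (3 pi / 5) = sin (2 pi / 5) with the addition formula and divide by s: this leaves 4
    c^2 - 2 c - 1 = 0. *)
Lemma cos_pi5_sq : c * c = (2 * c + 1) / 4.
Proof.
have := sin_3pi5; have -> : 3 * pi / 5 = 2 * pi / 5 + pi / 5 :> R by field.
rewrite sinD sin_2pi5 cos_2pi5 => e.
have {}e : s * (4 * c ^+ 2 - 1 - 2 * c) = 0.
  by rewrite -[RHS](subrr (2 * s * c)) -{1}e; ring.
move/eqP: e; rewrite mulf_eq0 (gt_eqF sin_pi5_gt0) /= => /eqP e.
have -> : c * c = (4 * c ^+ 2 - 1 - 2 * c) / 4 + (2 * c + 1) / 4 by field.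
by rewrite e; ring.
Qed.

Lemma sin_pi5_sq : s * s = (3 - 2 * c) / 4.
Proof.
have -> : s * s = 1 - c * c by rewrite -expr2 sin2cos2 expr2.
by rewrite cos_pi5_sq; field.
Qed.

Lemma sin_6pi5 : sin (6 * pi / 5 : R) = - s.
Proof.
have -> : 6 * pi / 5 = pi / 5 + pi :> R by field.
by rewrite sinD sinpi cospi; ring.
Qed.

Lemma cos_4pi5 : cos (4 * pi / 5 : R) = - c.
Proof.
have -> : 4 * pi / 5 = pi - pi / 5 :> R by field.
by rewrite cosB sinpi cospi; ring.
Qed.

(** The sum reduces to k = 1, and both ceilings, of 1 and of 1/2, equal 1. *)
Lemma Lambda_5 j : Lambda R 5 j = 1 - 2 * cos (2 * j%:R * pi / 5).
Proof.
have ceil_half : Num.ceil (1 / 2 : R) = 1.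
  by apply/le_anti/andP; split; [rewrite ceil_le_int; lra|rewrite -gtz0_ge1 ceil_gt0; lra].
rewrite /Lambda (_ : (5 - 3) %/ 2 = 1)%N // big_nat1.
have -> : (5 - 1) / 4 = 1 :> R by field.
have -> : (5 - 2 * 1 - 1) / 4 = 1 / 2 :> R by field.
by rewrite ceil_half ceil1 expr1 !mulr1 mulN1r mulrN.
Qed.

Lemma Lambda_5_1 : Lambda R 5 1 = 2 - 2 * c.
Proof. by rewrite Lambda_5 mulr1 cos_2pi5 expr2 cos_pi5_sq; field. Qed.

Lemma Lambda_5_2 : Lambda R 5 2 = 1 + 2 * c.
Proof.
rewrite Lambda_5 (_ : 2 * 2 * pi / 5 = 4 * pi / 5); last by field.
by rewrite cos_4pi5; ring.
Qed.

Lemma sin_arg_5 j k : pi * j%:R * k%:R / 5 = (j * k)%:R * pi / 5 :> R.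
Proof. by rewrite natrM; field. Qed.

Lemma delta_5 g i : delta R 5 g i = (-1) ^+ i * (4 / 5) *
  (sin ((2 * i + 1)%:R * pi / 5) * s * (2 - 2 * c) ^+ g +
   sin ((2 * (2 * i + 1))%:R * pi / 5) * (2 * s * c) * (1 + 2 * c) ^+ g).
Proof.
rewrite /delta (_ : ((5 - 1) %/ 2).+1 = 3)%N // big_ltn // big_nat1.
rewrite Lambda_5_1 Lambda_5_2 !sin_arg_5 mul1n mulr1.
by rewrite [pi * 2]mulrC sin_2pi5.
Qed.

(** The quadratic relation multiplied by an opaque power: [lra] treats the monomial in c, c and x as
    an atom and receives its linear value from here. *)
Let cosM x : c * c * x = (2 * c + 1) / 4 * x.
Proof. by rewrite cos_pi5_sq. Qed.

Lemma delta_5_0 g : delta R 5 g 0 =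
  ((3 - 2 * c) * (2 - 2 * c) ^+ g + (2 + 2 * c) * (1 + 2 * c) ^+ g) / 5.
Proof.
rewrite delta_5 mul1r sin_2pi5.
have -> : sin (1 * pi / 5) = s by rewrite mul1r.
have -> : 2 * s * c * (2 * s * c) = 4 * (s * s) * (c * c) by ring.
rewrite sin_pi5_sq cos_pi5_sq.
move: (_ ^+ g) (_ ^+ g) => x y; have := cosM y; have := cosM x; lra.
Qed.

Lemma delta_5_1 g : delta R 5 g 1 =
  (4 * c - 1) * ((1 + 2 * c) ^+ g - (2 - 2 * c) ^+ g) / 5.
Proof.
rewrite delta_5 expr1 sin_3pi5 sin_6pi5.
have -> : 2 * s * c * s = 2 * c * (s * s) by ring.
have -> : - s * (2 * s * c) = - (2 * c * (s * s)) by ring.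
rewrite sin_pi5_sq.
move: (_ ^+ g) (_ ^+ g) => x y; have := cosM y; have := cosM x; lra.
Qed.

(** In genus n + 1 the sine x has exponent - (2n + 1). One factor stays with the coefficient; the
    others combine with (5/4)^n into powers of the eigenvalue q = 5 / (4 x^2). *)
Lemma verlinde_term n (x y q : R) : x != 0 -> x * x * q = 5 / 4 ->
  (5 / 4) ^+ n * (y * (x ^+ (2 * n).+1)^-1) = y / x * q ^+ n.
Proof.
move=> x0 <-; rewrite exprMn -expr2 -exprM exprS.
have : x ^+ (2 * n) != 0 by rewrite expf_neq0.
by move: (x ^+ _) => z z0; field; rewrite z0 x0.
Qed.

Lemma cos_pi5_neq0 : c != 0.
Proof. by apply/eqP => c0; have := cos_pi5_sq; rewrite c0; lra. Qed.

Lemma verlinde_5 n i : verlinde R 5 n.+1 i =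
  sin ((2 * i + 1)%:R * pi / 5) / s * (2 + 2 * c) ^+ n +
  sin ((2 * (2 * i + 1))%:R * pi / 5) / (2 * s * c) * (3 - 2 * c) ^+ n.
Proof.
have s0 : s != 0 by rewrite gt_eqF // sin_pi5_gt0.
have t0 : 2 * s * c != 0 by rewrite !mulf_neq0 ?cos_pi5_neq0 // pnatr_eq0.
rewrite /verlinde (_ : ((5 - 1) %/ 2).+1 = 3)%N // big_ltn // big_nat1.
rewrite !sin_arg_5 mul1n mulr1 [pi * 2]mulrC sin_2pi5.
have -> : n.+1%:Z - 1 = n%:Z by rewrite intS addrC addKr.
have -> : 1 - 2 * n.+1%:Z = - (2 * n).+1%:Z by lia.
rewrite -!exprnN -exprnP mulrDr.
(* 4 s^2 = 3 - 2c, and (3 - 2c)(2 + 2c) = 5. *)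
rewrite (@verlinde_term _ s _ (2 + 2 * c)) //; last first.
  by rewrite sin_pi5_sq; have := cos_pi5_sq; lra.
(* 4 (2 s c)^2 = (3 - 2c)(1 + 2c) = 2 + 2c, so the roles in the same product are exchanged. *)
rewrite (@verlinde_term _ (2 * s * c) _ (3 - 2 * c)) //.
have -> : 2 * s * c * (2 * s * c) = 4 * (s * s) * (c * c) by ring.
rewrite sin_pi5_sq cos_pi5_sq.
by have := cos_pi5_sq; have := cosM c; lra.
Qed.

Lemma verlinde_5_0 n : verlinde R 5 n.+1 0 = (2 + 2 * c) ^+ n + (3 - 2 * c) ^+ n.
Proof.
have s0 : s != 0 by rewrite gt_eqF // sin_pi5_gt0.
have t0 : 2 * s * c != 0 by rewrite !mulf_neq0 ?cos_pi5_neq0 // pnatr_eq0.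
rewrite verlinde_5 sin_2pi5 (_ : sin _ = s); last by rewrite mul1r.
by rewrite !divff // !mul1r.
Qed.

Lemma verlinde_5_1 n : verlinde R 5 n.+1 1 =
  2 * c * (2 + 2 * c) ^+ n - (2 * c - 1) * (3 - 2 * c) ^+ n.
Proof.
have s0 : s != 0 by rewrite gt_eqF // sin_pi5_gt0.
have c0 := cos_pi5_neq0.
rewrite verlinde_5 sin_3pi5 sin_6pi5.
have -> : 2 * s * c / s = 2 * c by field.
have -> : - s / (2 * s * c) = - (2 * c - 1).
  have t0 : 2 * s * c != 0 by rewrite !mulf_neq0 // pnatr_eq0.
  apply: (mulIf t0); rewrite divfK //.
  by have := cosM s; lra.
by rewrite mulNr.
Qed.

Arguments walks : simpl never.

(** In the explicit formulas the coefficients of each of the four powers form an eigenvector of C,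
    so the inductive step is linear modulo the relation for c^2. The start is genus 1, since the
    Verlinde powers have exponent g - 1. *)
Lemma walks_dim n :
  ((walks n.+1 0)%:R, (walks n.+1 1)%:R, (walks n.+1 2)%:R, (walks n.+1 3)%:R) =
  (e_dim R 5 n.+1 0, e_dim R 5 n.+1 1, o_dim R 5 n.+1 1, o_dim R 5 n.+1 0).
Proof.
rewrite /e_dim /o_dim !verlinde_5_0 !verlinde_5_1 !delta_5_0 !delta_5_1.
elim: n => [|n].
  have [-> -> -> ->] : [/\ walks 1 0 = 2, walks 1 1 = 1, walks 1 2 = 0 & walks 1 3 = 0]%N by [].
  rewrite !expr0 !expr1; have h := cos_pi5_sq.
  congr (_, _, _, _); lra.
case=> e0 e1 e2 e3.
have natE i j k : (2 * i + j + k)%N%:R = 2 * i%:R + j%:R + k%:R :> R.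
  by rewrite natrD natrD natrM.
have w0 : (walks n.+2 0)%:R = 2 * (walks n.+1 0)%:R + 0 + (walks n.+1 1)%:R :> R.
  exact: (natE _ 0%N).
have w1 : (walks n.+2 1)%:R =
    2 * (walks n.+1 1)%:R + (walks n.+1 0)%:R + (walks n.+1 2)%:R :> R by exact: natE.
have w2 : (walks n.+2 2)%:R =
    2 * (walks n.+1 2)%:R + (walks n.+1 1)%:R + (walks n.+1 3)%:R :> R by exact: natE.
have w3 : (walks n.+2 3)%:R = 2 * (walks n.+1 3)%:R + (walks n.+1 2)%:R + 0 :> R.
  exact: (natE _ _ 0%N).
rewrite w0 w1 w2 w3 e0 e1 e2 e3 !(exprS (2 + 2 * c) n) !(exprS (3 - 2 * c) n).
rewrite !(exprS (2 - 2 * c) n.+1) !(exprS (1 + 2 * c) n.+1).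
move: ((2 + 2 * c) ^+ n) ((3 - 2 * c) ^+ n) ((2 - 2 * c) ^+ n.+1) ((1 + 2 * c) ^+ n.+1).
move=> x y z t.
have hx := cosM x; have hy := cosM y; have hz := cosM z; have ht := cosM t.
congr (_, _, _, _); lra.
Qed.

End VerlindeNumbers.

(** Walks of at most three steps from 0 never pass beyond 3, so the upper end of the path is not
    felt and the reflection principle on the half-line explains the binomial differences; a finite
    check suffices. *)
Lemma weyl_dim_walks g : (1 <= g < 4)%N ->
  [/\ weyl_dim g g%:Z = (walks g 0)%:Z, weyl_dim g (g%:Z - 1) = (walks g 1)%:Z,
      weyl_dim g (g%:Z - 2) = (walks g 2)%:Z & weyl_dim g (g%:Z - 3) = (walks g 3)%:Z].
Proof. by case: g => [|[|[|[|]]]]. Qed.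

Lemma gow_dim_walks (K : fieldType) g k m (V : gow_module K g k) :
  5%N \in [pchar K] -> (m <= 3)%N -> (k + m)%N = g -> gow_dim V = walks g m.
Proof.
move=> ch5 m3 kmg.
have nz (i : nat) : (0 < i < 5)%N -> i%:R != 0 :> K.
  by case/andP => i0 i5; rewrite -(dvdn_pcharf ch5) gtnNdvd.
have two := nz 2%N isT; have three := nz 3%N isT.
(* The torus scalar is 2: it differs from its inverse because 4 - 1 = 3 is nonzero in characteristic
   5. *)
rewrite -(iso_rank_sympl ch5 m3 kmg); apply: (@gow_dim_iso_rank K g k _ 2%:R) => //.
- by rewrite -kmg leq_addr.
- by rewrite -subr_eq0 -(@natrB _ 2 1) // oner_eq0.
- by rewrite -(inj_eq (mulIf two)) mulVf // -natrM -subr_eq0 -(@natrB _ 4 1).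
Qed.

Theorem corollary3 (R : realType) :
  (forall (K : fieldType) (g : nat), 5%N \in [pchar K] -> (4 <= g)%N ->
   forall (V0 : gow_module K g g) (V1 : gow_module K g (g - 1))
          (V2 : gow_module K g (g - 2)) (V3 : gow_module K g (g - 3)),
   ((gow_dim V0)%:R, (gow_dim V1)%:R, (gow_dim V2)%:R, (gow_dim V3)%:R)
   = (e_dim R 5 g 0, e_dim R 5 g 1, o_dim R 5 g 1, o_dim R 5 g 0))
  /\
  (forall g : nat, (1 <= g < 4)%N ->
   ((weyl_dim g g%:Z)%:~R, (weyl_dim g (g%:Z - 1))%:~R,
    (weyl_dim g (g%:Z - 2))%:~R, (weyl_dim g (g%:Z - 3))%:~R)
   = (e_dim R 5 g 0, e_dim R 5 g 1, o_dim R 5 g 1, o_dim R 5 g 0)).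
Proof.
split=> [K g ch5 g4 V0 V1 V2 V3|g g14].
  rewrite (gow_dim_walks V0 ch5 (m := 0)) ?addn0 //.
  have g3 : (3 <= g)%N by apply: ltnW.
  rewrite (gow_dim_walks V1 ch5 (m := 1)) ?subnK //; last by apply: leq_trans g3.
  rewrite (gow_dim_walks V2 ch5 (m := 2)) ?subnK //; last by apply: leq_trans g3.
  rewrite (gow_dim_walks V3 ch5 (m := 3)) ?subnK //.
  by case: g g4 {V0 V1 V2 V3 g3} => // g _; apply: walks_dim.
have [-> -> -> ->] := weyl_dim_walks g14.
rewrite -!pmulrn; case: g g14 => // g _; exact: walks_dim.
Qed.
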